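(* Let $(G,g)$ be a connected almost abelian Lie group endowed with a left-invariant Riemannian metric. If $(G,g)$ has constant non-zero sectional curvature, then the metric $g$ (viewed as a symmetric 2-tensor) cannot be expressed as a polynomial (with real coefficients, with respect to the symmetric product) in right-invariant vector fields and Killing vector fields induced by skew-symmetric derivations.
   Context: A Lie group is almost abelian if its Lie algebra $\mathfrak g$ contains an abelian ideal of codimension 1. Here $\dim G\ge 2$, so that sectional curvature is meaningful. For a vector space $V$, $\mathrm{Sym}^p(V)\subset V^{\otimes p}$ is spanned by the symmetric products $v_1\cdot\ldots\cdot v_p:=\sum_{\sigma\in\mathfrak S_p}v_{\sigma(1)}\otimes\ldots\otimes v_{\sigma(p)}$; the symmetric product makes $\mathrm{Sym}^\bullet(V)$ the commutative symmetric algebra of $V$, and it is applied pointwise to symmetric tensor fields. Using the metric to identify $TG$ with $T^*G$, the metric $g$ is viewed as the symmetric 2-tensor field $\tfrac12\sum_i e_i\cdot e_i\in\Gamma(\mathrm{Sym}^2TG)$ for any local orthonormal frame $\{e_i\}$. Right-invariant vector fields: for $x\in\mathfrak g$, $(\xi_x)_u=(\mathcal R_u)_*x$ with $\mathcal R_u(v)=vu$; these are Killing. Killing vector fields induced by skew-symmetric derivations: let $\mathrm{Dera}(\mathfrak g)$ be the set of $T\in\mathfrak{so}(\mathfrak g)$ (skew-symmetric with respect to the inner product $g$ on $\mathfrak g$) with $T[x,y]=[Tx,y]+[x,Ty]$ for all $x,y\in\mathfrak g$. If $G$ is simply connected, for $T\in\mathrm{Dera}(\mathfrak g)$ and $t\in\mathbb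 R$ let $f_t$ be the isometric Lie group automorphism of $G$ with differential $e^{tT}$ at the identity; then $(\xi_T)_u:=\frac{d}{dt}\big|_{t=0}f_t(u)$ is a Killing vector field, called induced by $T$. If $G=\tilde G/\Gamma$ with $\tilde G$ the universal cover and $\Gamma$ a discrete central subgroup, $\xi_T$ on $\tilde G$ descends to $G$ if and only if $f_t(\gamma)=\gamma$ for all $t\in\mathbb R$, $\gamma\in\Gamma$, and in that case the resulting field on $G$ is called the Killing vector field induced by $T$. *)

(* Defs.v *)
From HB Require Import structures.
From mathcomp Require Import all_boot all_order all_algebra.
From mathcomp Require Import all_classical all_reals all_analysis.
From mathcomp Require Import perm.
From mathcomp Require mpoly.
Import numFieldNormedType.Exports.
Import Order.TTheory GRing.Theory Num.Theory.

Set Implicit Arguments.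
Unset Strict Implicit.
Unset Printing Implicit Defensive.

Local Open Scope classical_set_scope.
Local Open Scope ring_scope.

(* On an open set U of a finite-dimensional space V this is the usual C^k:     *)
(* differentiability together with C^(k-1) directional derivatives.           *)
Fixpoint Ck_on (R : realType) (V W : normedModType R) (k : nat) (U : set V)
    (f : V -> W) : Prop :=
  if k is k'.+1 then
    (forall x, U x -> differentiable f x) /\
    (forall v : V, Ck_on k' U (fun x => 'D_v f x))
  else forall x, U x -> {for x, continuous f}.

Definition smooth_on (R : realType) (V W : normedModType R) (U : set V)
    (f : V -> W) : Prop := forall k, Ck_on k U f.

(* The atlas is indexed by the points of M: (chart u, chart_dom u) is a chart *)
(* around u, and chart_inv u is its inverse on chart u @` chart_dom u.        *)
HB.mixin Record isSmoothManifold (R : realType) (n : nat) M of Topological M := {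
  chart : M -> M -> 'rV[R]_n ;
  chart_inv : M -> 'rV[R]_n -> M ;
  chart_dom : M -> set M ;
  mem_chart_dom : forall u, chart_dom u u ;
  open_chart_dom : forall u, open (chart_dom u) ;
  open_chart_cod : forall u, open (chart u @` chart_dom u) ;
  chartK : forall u v, chart_dom u v -> chart_inv u (chart u v) = v ;
  chart_continuous : forall u v, chart_dom u v ->
    {for v, continuous (chart u)} ;
  chart_inv_continuous : forall u p, (chart u @` chart_dom u) p ->
    {for p, continuous (chart_inv u)} ;
  chart_compatible : forall u v,
    smooth_on (chart u @` (chart_dom u `&` chart_dom v))
              (chart v \o chart_inv u) ;
  manifold_hausdorff : hausdorff_space M ;
  manifold_second_countable : @second_countable M
}.

#[short(type="smoothManifoldType")]
HB.structure Definition SmoothManifold (R : realType) (n : nat) :=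
  {M of isSmoothManifold R n M & Topological M}.

Section Manifolds.
Context {R : realType}.

Definition chart_cod {n} {M : smoothManifoldType R n} (u : M) : set 'rV[R]_n :=
  chart u @` chart_dom u.

Definition smooth_map_on {m n} {M : smoothManifoldType R m}
    {N : smoothManifoldType R n} (U : set M) (f : M -> N) : Prop :=
  (forall u, U u -> {for u, continuous f}) /\
  forall (u : M) (v : N),
    smooth_on [set p | [/\ chart_cod u p, U (chart_inv u p) &
                           chart_dom v (f (chart_inv u p))]]
              (chart v \o f \o chart_inv u).

Definition smooth_map {m n} {M : smoothManifoldType R m}
    {N : smoothManifoldType R n} (f : M -> N) : Prop :=
  smooth_map_on [set: M] f.

(* The tangent space T_u M is 'rV[R]_n: a row vector stands for the tangent   *)
(* vector at u with these components in the chart [chart u]. A vector field   *)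
(* is a map M -> 'rV[R]_n whose value at u is read in T_u M.                  *)
Definition mdiff {m n} {M : smoothManifoldType R m}
    {N : smoothManifoldType R n} (f : M -> N) (u : M) :
    'rV[R]_m -> 'rV[R]_n :=
  'd (chart (f u) \o f \o chart_inv u) (chart u u).

Section OneManifold.
Context {n : nat} {M : smoothManifoldType R n}.
Implicit Types (X Y Z : M -> 'rV[R]_n) (f : M -> R) (u v : M).

Definition smooth_fun f : Prop :=
  forall u, smooth_on (chart_cod u) (f \o chart_inv u).

(* components, in the chart [chart u], of X at the point of coordinates p *)
Definition vf_in_chart X u (p : 'rV[R]_n) : 'rV[R]_n :=
  let v := chart_inv u p in 'd (chart u \o chart_inv v) (chart v v) (X v).

Definition smooth_vf X : Prop :=
  forall u, smooth_on (chart_cod u) (vf_in_chart X u).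

Definition vf_deriv X f u : R := 'D_(X u) (f \o chart_inv u) (chart u u).

Definition vf_bracket X Y u : 'rV[R]_n :=
  'D_(X u) (vf_in_chart Y u) (chart u u) -
  'D_(Y u) (vf_in_chart X u) (chart u u).

Implicit Type g : M -> 'rV[R]_n -> 'rV[R]_n -> R.

Definition metric_in_chart g u (x y p : 'rV[R]_n) : R :=
  let v := chart_inv u p in
  g v ('d (chart v \o chart_inv u) p x) ('d (chart v \o chart_inv u) p y).

Record riemannian_metric g : Prop := {
  metric_linear : forall u a x y z, g u (a *: x + y) z = a * g u x z + g u y z ;
  metric_sym : forall u x y, g u x y = g u y x ;
  metric_pos : forall u x, x != 0 -> 0 < g u x x ;
  metric_smooth : forall u x y, smooth_on (chart_cod u) (metric_in_chart g u x y)
}.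

Record levi_civita g (nabla : (M -> 'rV[R]_n) -> (M -> 'rV[R]_n) -> M -> 'rV[R]_n)
    : Prop := {
  nabla_smooth : forall X Y, smooth_vf X -> smooth_vf Y -> smooth_vf (nabla X Y) ;
  nablaDl : forall X Y Z, smooth_vf X -> smooth_vf Y -> smooth_vf Z ->
    forall u, nabla (fun v => X v + Y v) Z u = nabla X Z u + nabla Y Z u ;
  nablaZl : forall f X Y, smooth_fun f -> smooth_vf X -> smooth_vf Y ->
    forall u, nabla (fun v => f v *: X v) Y u = f u *: nabla X Y u ;
  nablaDr : forall X Y Z, smooth_vf X -> smooth_vf Y -> smooth_vf Z ->
    forall u, nabla X (fun v => Y v + Z v) u = nabla X Y u + nabla X Z u ;
  nabla_leibniz : forall f X Y, smooth_fun f -> smooth_vf X -> smooth_vf Y ->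
    forall u, nabla X (fun v => f v *: Y v) u =
      vf_deriv X f u *: Y u + f u *: nabla X Y u ;
  nabla_metric : forall X Y Z, smooth_vf X -> smooth_vf Y -> smooth_vf Z ->
    forall u, vf_deriv X (fun v => g v (Y v) (Z v)) u =
      g u (nabla X Y u) (Z u) + g u (Y u) (nabla X Z u) ;
  nabla_torsion_free : forall X Y, smooth_vf X -> smooth_vf Y ->
    forall u, nabla X Y u - nabla Y X u = vf_bracket X Y u
}.

Definition curvature
    (nabla : (M -> 'rV[R]_n) -> (M -> 'rV[R]_n) -> M -> 'rV[R]_n) X Y Z u :
    'rV[R]_n :=
  nabla X (nabla Y Z) u - nabla Y (nabla X Z) u - nabla (vf_bracket X Y) Z u.

Definition sectional_curvature g nabla X Y u : R :=
  g u (curvature nabla X Y Y u) (X u) /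
  (g u (X u) (X u) * g u (Y u) (Y u) - g u (X u) (Y u) ^+ 2).

Definition constant_sectional_curvature g (c : R) : Prop :=
  exists2 nabla, levi_civita g nabla &
    forall u X Y, smooth_vf X -> smooth_vf Y -> free [:: X u; Y u] ->
      sectional_curvature g nabla X Y u = c.

End OneManifold.

Definition simply_connected (T : topologicalType) : Prop :=
  (forall x y : T, exists gamma : R -> T,
     [/\ {within `[0, 1], continuous gamma}, gamma 0 = x & gamma 1 = y]) /\
  (forall gamma : R -> T, {within `[0, 1], continuous gamma} ->
     gamma 0 = gamma 1 ->
     exists H : R * R -> T,
       {within `[0, 1] `*` `[0, 1], continuous H} /\
       forall s : R, s \in `[0, 1] ->
         [/\ H (0, s) = gamma s, H (1, s) = gamma 0,
             H (s, 0) = gamma 0 & H (s, 1) = gamma 0]).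

End Manifolds.

HB.mixin Record isLieGroup (R : realType) (n : nat) G
    of SmoothManifold R n G & Group G := {
  mulg_continuous : continuous (fun w : G * G => (w.1 * w.2)%g) ;
  mulg_smooth : forall u v w : G,
    smooth_on
      [set p : 'rV[R]_n * 'rV[R]_n |
        [/\ chart_cod u p.1, chart_cod v p.2 &
            chart_dom w (chart_inv u p.1 * chart_inv v p.2)%g]]
      (fun p => chart w (chart_inv u p.1 * chart_inv v p.2)%g) ;
  invg_smooth : smooth_map (fun u : G => (u^-1)%g)
}.

#[short(type="lieGroupType")]
HB.structure Definition LieGroup (R : realType) (n : nat) :=
  {G of isLieGroup R n G & SmoothManifold R n G & Group G}.

Section LieGroups.
Context {R : realType} {n : nat}.

(* The Lie algebra of G is T_1 G = 'rV[R]_n with the bracket [lie_bracket G]. *)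
Section OneLieGroup.
Context {G : lieGroupType R n}.
Implicit Types (x y : 'rV[R]_n) (u v : G).

Definition left_invariant_vf x u : 'rV[R]_n := mdiff (fun v => (u * v)%g) 1%g x.

Definition right_invariant_vf x u : 'rV[R]_n := mdiff (fun v => (v * u)%g) 1%g x.

Definition left_invariant_metric (g : G -> 'rV[R]_n -> 'rV[R]_n -> R) : Prop :=
  forall u v x y,
    g (u * v)%g (mdiff (fun w => (u * w)%g) v x) (mdiff (fun w => (u * w)%g) v y)
    = g v x y.

End OneLieGroup.

Definition lie_bracket (G : lieGroupType R n) (x y : 'rV[R]_n) : 'rV[R]_n :=
  vf_bracket (left_invariant_vf x) (left_invariant_vf y) (1%g : G).

Definition almost_abelian (G : lieGroupType R n) : Prop :=
  exists h : {vspace 'rV[R]_n},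
    [/\ (\dim h).+1 = n,
        forall x y, y \in h -> lie_bracket G x y \in h &
        forall x y, x \in h -> y \in h -> lie_bracket G x y = 0].

Definition group_morphism (G H : lieGroupType R n) (f : G -> H) : Prop :=
  forall u v, f (u * v)%g = (f u * f v)%g.

Definition lie_automorphism (G : lieGroupType R n) (f : G -> G) : Prop :=
  [/\ smooth_map f, group_morphism f &
      exists2 f', cancel f f' /\ cancel f' f & smooth_map f'].

Definition local_diffeomorphism (G H : lieGroupType R n) (f : G -> H) : Prop :=
  smooth_map f /\
  forall u, exists (U : set G) (s : H -> G),
    [/\ open U, U u, open (f @` U), forall v, U v -> s (f v) = v &
        smooth_map_on (f @` U) s].

(* pi presents G as the quotient of its universal cover Gt by ker pi, a      *)
(* discrete (hence central) subgroup.                                         *)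
Definition universal_cover (Gt G : lieGroupType R n) (pi : Gt -> G) : Prop :=
  [/\ simply_connected (R := R) Gt, group_morphism pi,
      forall u, exists ut, pi ut = u & local_diffeomorphism pi].

Definition expm (A : 'M[R]_n) : 'M[R]_n :=
  limn (series (fun k => (k`!%:R)^-1 *: A ^+ k)).

(* Endomorphisms T of the Lie algebra are matrices acting by x |-> x *m T. *)
Definition Dera (G : lieGroupType R n) (g : G -> 'rV[R]_n -> 'rV[R]_n -> R)
    (T : 'M[R]_n) : Prop :=
  (forall x y, g 1%g (x *m T) y = - g 1%g x (y *m T)) /\
  (forall x y, lie_bracket G x y *m T =
     lie_bracket G (x *m T) y + lie_bracket G x (y *m T)).

(* The Lie algebra of Gt is identified with that of G by the differential of  *)
(* pi at 1; f t is then the automorphism of Gt with differential e^(tT). It   *)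
(* is isometric because T is skew-symmetric, and f 0 is the identity, so that *)
(* the velocity of t |-> f t u at 0 lies in the tangent space at u.           *)
Definition induced_killing_vf (G : lieGroupType R n) (T : 'M[R]_n)
    (xi : G -> 'rV[R]_n) : Prop :=
  exists (Gt : lieGroupType R n) (pi : Gt -> G) (f : R -> Gt -> Gt)
         (xit : Gt -> 'rV[R]_n),
    [/\ universal_cover pi,
        forall t, lie_automorphism (f t) /\
          forall x, mdiff pi 1%g (mdiff (f t) 1%g x) =
                    mdiff pi 1%g x *m expm (t *: T),
        forall t gamma, pi gamma = 1%g -> f t gamma = gamma,
        forall u, is_derive (0 : R) 1 (fun t => chart u (f t u)) (xit u) &
        forall u, xi (pi u) = mdiff pi u (xit u)].

Definition killing_generator (G : lieGroupType R n)
    (g : G -> 'rV[R]_n -> 'rV[R]_n -> R) (xi : G -> 'rV[R]_n) : Prop :=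
  (exists x, xi = right_invariant_vf x) \/
  (exists2 T, Dera g T & induced_killing_vf T xi).

End LieGroups.

Section SymmetricTensors.
Context {R : realType} {n : nat}.

(* elements of the p-th tensor power of 'rV[R]_n, by their components *)
Definition tensor (p : nat) := {ffun p.-tuple 'I_n -> R^o}.

Definition symprod (p : nat) (v : 'I_p -> 'rV[R]_n) : tensor p :=
  [ffun I => \sum_(s : 'S_p) \prod_(k < p) v (s k) 0 (tnth I k)].

(* The list of factors of the monomial m, variable i being replaced by v i. *)
Definition monomial_factors (k : nat) (m : mpoly.multinom k)
    (v : 'I_k -> 'rV[R]_n) : seq 'rV[R]_n :=
  flatten [seq nseq (mpoly.fun_of_multinom m i) (v i) | i <- enum 'I_k].

(* component in Sym^p of the value of P at v, in the algebra (+)_p Sym^p *)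
Definition sym_eval (k : nat) (P : mpoly.mpoly k R) (v : 'I_k -> 'rV[R]_n)
    (p : nat) : tensor p :=
  \sum_(m <- mpoly.msupp P | mpoly.mdeg m == p)
    mpoly.mcoeff m P *: symprod (fun j : 'I_p => nth 0 (monomial_factors m v) j).

(* S is 1/2 sum_i e_i . e_i for an orthonormal basis e of the inner product b; *)
(* the sum is the same for every such basis.                                  *)
Definition is_metric_tensor (b : 'rV[R]_n -> 'rV[R]_n -> R) (S : tensor 2) :
    Prop :=
  exists2 e : 'I_n -> 'rV[R]_n,
    forall i j, b (e i) (e j) = (i == j)%:R &
    S = 2^-1 *: \sum_(i < n) symprod (fun _ : 'I_2 => e i).

End SymmetricTensors.

Definition metric_is_polynomial_in (R : realType) (n : nat)
    (M : smoothManifoldType R n) (g : M -> 'rV[R]_n -> 'rV[R]_n -> R)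
    (k : nat) (xi : 'I_k -> M -> 'rV[R]_n) (P : mpoly.mpoly k R) : Prop :=
  forall u : M,
    is_metric_tensor (g u) (sym_eval P (fun i => xi i u) 2) /\
    forall p, p != 2%N -> sym_eval P (fun i => xi i u) p = 0.

(* Main.v *)
Require Import Defs.
From HB Require Import structures.
From mathcomp Require Import all_boot all_order all_algebra.
From mathcomp Require Import all_classical all_reals all_analysis.
From mathcomp Require Import perm.
From mathcomp Require mpoly.
From mathcomp Require Import ring lra.
Import numFieldNormedType.Exports.
Import Order.TTheory GRing.Theory Num.Theory.
Local Open Scope classical_set_scope.
Local Open Scope ring_scope.
Set Implicit Arguments.
Unset Strict Implicit.
Unset Printing Implicit Defensive.

(* If every generator is invariant under right translation by u, then so is the
   metric, viewed as a polynomial in the generators: right translation by u is an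
   isometry. Right invariant fields are invariant under all right translations.
   For the fields induced by derivations, let b be orthogonal to the abelian ideal:
   constant non-zero curvature forces T b = 0 for every skew-symmetric derivation T,
   so the automorphisms f_t fix the points exp (s b) and the induced fields vanish
   there. Hence the left invariant field of b, whose flow is right translation by
   exp (s b), is Killing, i.e. ad b is skew-symmetric; but then the planes
   containing b are flat, a contradiction.
   The points exp (2^-j b) are obtained without differential equations, by
   linearizing the squaring map of G at the identity. *)

(** * Differentiability and smoothness *)

(** Invariance is needed only at the points u_j = exp(2^-j b), which tend to the identity with
    velocity [b]. At u_j every generator takes the value that right translation carries over from
    the identity: a field induced by a derivation vanishes at both points. So one linear map, the
    differential of that translation, moves all generator values at once; symmetric products are
    natural under linear maps, and the metric tensor follows. Skewness of [ad b] is then read off in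
    the limit, without flows: the left and right fields of [x] have equal length at u_j, and 2^j
    times their difference tends to [[b, x]].

    Existence and uniqueness of dyadic roots replace those of one-parameter subgroups. A morphism
    maps the roots of [b] to the roots of the image of [b] under its differential, so an
    automorphism whose differential fixes [b] fixes each u_j. The same argument lifts the roots to
    the universal cover, where the automorphisms f_t live. *)

Section Calculus.
Context {R : realType} {V W : normedModType R}.
Implicit Types (f g : V -> W) (x v : V) (U : set V).

Lemma diff_near_le f x : differentiable f x -> forall e : R, 0 < e ->
  \forall y \near x, `|f y - f x - 'd f x (y - x)| <= e * `|y - x|.
Proof.
move=> /diff_locally df e e0.
have /eqaddoP/(_ e e0) := df.
rewrite [X in _ -> X](near_shift 0 x) /=; apply: filterS => h /=.
by rewrite subr0 addrK -addrA -opprD.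
Qed.

Lemma diff_near_unique f (df : {linear V -> W}) x : continuous df ->
    (forall e : R, 0 < e ->
       \forall y \near x, `|f y - f x - df (y - x)| <= e * `|y - x|) ->
  differentiable f x /\ 'd f x = df :> (V -> W).
Proof.
move=> dfc h.
have E : f \o shift x = cst (f x) + df +o_ 0 id.
  apply/eqaddoP => e e0; have := h e e0.
  rewrite [X in X -> _](near_shift 0 x) /=; apply: filterS => y /=.
  by rewrite subr0 addrK -addrA -opprD.
have D := diff_unique dfc E; split=> //.
by apply/diff_locallyP; rewrite D.
Qed.

Lemma near_eq_diff f g x : (\forall y \near x, f y = g y) -> differentiable f x ->
  differentiable g x /\ 'd g x = 'd f x :> (V -> W).
Proof.
move=> fg df; apply: diff_near_unique; first exact: diff_continuous.
move=> e e0; have fgx := nbhs_singleton fg.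
by apply: filterS2 fg (diff_near_le df e0) => y <-; rewrite -fgx.
Qed.

Lemma Ck_on_eq k U f g : open U -> (forall x, U x -> f x = g x) ->
  Ck_on k U f -> Ck_on k U g.
Proof.
move=> oU; have nU x : U x -> nbhs x U by move=> Ux; exact: open_nbhs_nbhs.
elim: k f g => [|k IH] f g fg /=.
  move=> fc x Ux; suff: g y @[y --> x] --> g x by [].
  rewrite -(fg x Ux); apply: cvg_trans (fc x Ux); apply: near_eq_cvg.
  by apply: filterS (nU _ Ux) => y; exact: fg.
have nfg x : U x -> \forall y \near x, f y = g y.
  by move=> Ux; apply: filterS (nU _ Ux); exact: fg.
move=> [df Df]; split=> [x Ux|v]; first by have [] := near_eq_diff (nfg _ Ux) (df _ Ux).
by apply: (IH _ _ _ (Df v)) => x Ux; apply: near_eq_derive; exact: nfg.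
Qed.

Lemma smooth_on_eq U f g : open U -> (forall x, U x -> f x = g x) ->
  smooth_on U f -> smooth_on U g.
Proof. by move=> oU fg sf k; exact: Ck_on_eq fg (sf k). Qed.

Lemma smooth_on_sub U U' f : U' `<=` U -> smooth_on U f -> smooth_on U' f.
Proof.
move=> sU sf k; elim: k f {sf}(sf k) => [|k IH] f /=.
  by move=> fc x /sU; exact: fc.
by move=> [df Df]; split=> [x /sU|v]; [exact: df|exact/IH/Df].
Qed.

Lemma smooth_on_differentiable U f x : smooth_on U f -> U x -> differentiable f x.
Proof. by move=> /(_ 1%N) [df _] /df. Qed.

Lemma smooth_on_derive U f v : smooth_on U f -> smooth_on U (fun x => 'D_v f x).
Proof. by move=> sf k; have [_] := sf k.+1; exact. Qed.

(** Differentiability read along a sequence with velocity [b]; for the dyadic points, [r k] is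
    [2 ^+ k]. All derivatives in direction [b] are extracted in this form. *)
Lemma diff_seq f x (r : nat -> R) (z : nat -> V) (b : V) : differentiable f x ->
    z @ \oo --> x -> (fun k => r k *: (z k - x)) @ \oo --> b ->
  (fun k => r k *: (f (z k) - f x)) @ \oo --> 'd f x b.
Proof.
move=> df zx rb; apply/cvgrPdist_le => e e0.
have dfc : continuous ('d f x) by exact: diff_continuous.
have L : (fun k => 'd f x (r k *: (z k - x))) @ \oo --> 'd f x b.
  by apply: continuous_cvg rb; exact: dfc.
(* The rescaled increments have norm at most [|b| + 1] eventually, so this slope leaves a remainder
   of at most [e / 2]. *)
pose e' := e / 2 / (`|b| + 1).
have b1 : 0 < `|b| + 1 by rewrite ltr_wpDl.
have e'0 : 0 < e' by rewrite !divr_gt0.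
have N := zx _ (diff_near_le df e'0).
have M : \forall k \near \oo, `|r k *: (z k - x)| <= `|b| + 1.
  have /cvgr_norm_le := rb; apply.
  by rewrite ltrDl.
have e20 : 0 < e / 2 by rewrite divr_gt0.
have N2 : \forall k \near \oo,
    `|'d f x b - 'd f x (r k *: (z k - x))| <= e / 2.
  by move/cvgrPdist_le : L; apply.
near=> k.
have -> : 'd f x b - r k *: (f (z k) - f x) =
   ('d f x b - 'd f x (r k *: (z k - x))) -
   r k *: (f (z k) - f x - 'd f x (z k - x)).
  by rewrite [X in _ - X - _]linearZ /= [in RHS]scalerBr opprB [in RHS]addrA subrK.
apply: (le_trans (ler_normB _ _)); rewrite [leRHS](splitr e); apply: lerD.
  by near: k.
rewrite normrZ.
have h1 : `|f (z k) - f x - 'd f x (z k - x)| <= e' * `|z k - x| by near: k.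
have h2 : `|r k| * `|z k - x| <= `|b| + 1 by rewrite -normrZ; near: k.
apply: (le_trans (ler_wpM2l (normr_ge0 _) h1)).
rewrite mulrCA; apply: (le_trans (ler_wpM2l (ltW e'0) h2)).
by rewrite /e' divfK // gt_eqF.
Unshelve. all: by end_near. Qed.

End Calculus.

Section Composition.
Context {R : realType} {U V W : normedModType R}.

Lemma diff_affine (L : {linear U -> V}) (q : V) (x : U) : continuous L ->
  differentiable (fun p => L p + q) x /\ 'd (fun p => L p + q) x = L :> (U -> V).
Proof.
move=> Lc; apply: diff_near_unique => // e e0; near=> y.
rewrite opprD addrACA subrr addr0 -linearB subrr normr0 mulr_ge0 //.
exact: ltW.
Unshelve. all: by end_near. Qed.

(** An affine substitution turns the derivative along [v] into the derivative along [L v], of the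
    same shape, so the induction on [k] closes. Slices and the diagonal of the group multiplication
    are of this form. *)
Lemma Ck_on_affine (k : nat) (A : set V) (f : V -> W) (L : {linear U -> V}) (q : V) :
  continuous L -> open A -> Ck_on k A f ->
  Ck_on k [set p | A (L p + q)] (fun p => f (L p + q)).
Proof.
move=> Lc oA.
have Ac : continuous (fun p => L p + q).
  by move=> x; apply: differentiable_continuous; have [] := diff_affine q x Lc.
have oB : open [set p | A (L p + q)] by have /continuousP := Ac; exact.
elim: k f => [|k IH] f /=.
  by move=> fc x Ax; apply: continuous_comp; [exact: Ac|exact: fc].
move=> [df Df]; split=> [x Ax|v].
  by apply: differentiable_comp; [have [] := diff_affine q x Lc|exact: df].
apply: Ck_on_eq (IH _ (Df (L v))) => // x Ax.
have [dA DA] := diff_affine q x Lc.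
have dfx := df _ Ax.
by rewrite !deriveE // ?(diff_comp dA) //=; [rewrite DA|exact: differentiable_comp].
Qed.

Lemma smooth_on_affine (A : set V) (f : V -> W) (L : {linear U -> V}) (q : V) :
  continuous L -> open A -> smooth_on A f ->
  smooth_on [set p | A (L p + q)] (fun p => f (L p + q)).
Proof. by move=> Lc oA sf k; exact: Ck_on_affine. Qed.

Lemma diff_comp_near (f : U -> V) (g : V -> W) (h : U -> W) x :
    differentiable f x -> differentiable g (f x) ->
    (\forall y \near x, h y = g (f y)) ->
  differentiable h x /\ forall v, 'd h x v = 'd g (f x) ('d f x v).
Proof.
move=> df dg hgf.
have dgf : differentiable (g \o f) x by exact: differentiable_comp.
have [dh ->] : differentiable h x /\ 'd h x = 'd (g \o f) x :> (U -> W).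
  by apply: near_eq_diff dgf; apply: filterS hgf => y.
by split=> // v; rewrite diff_comp.
Qed.

End Composition.

(** * Mean values and symmetry of second derivatives *)

Section MeanValue.
Context {R : realType} {V : normedModType R}.

Lemma mean_value (f : V -> R) (p v : V) :
    (forall s, s \in `[0 : R, 1] -> differentiable f (p + s *: v)) ->
  exists2 s, s \in `]0 : R, 1[ & f (p + v) - f p = 'D_v f (p + s *: v).
Proof.
move=> df; pose h (s : R) := f (p + s *: v).
have dh s : s \in `[0 : R, 1] -> is_derive s 1 h ('D_v f (p + s *: v)).
  move=> s01; pose L := *:%R^~ v : R -> V.
  have dA : is_diff s (fun t : R => p + t *: v) (L : R -> V).
    have -> : L = 0 + L by rewrite add0r.
    exact: is_diffD.
  have dh : differentiable h s.
    by apply: differentiable_comp; [exact: ex_diff|exact: df].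
  apply: DeriveDef; first exact: diff_derivable.
  rewrite !deriveE //; last exact: df.
  rewrite (@diff_comp R R V R (fun t : R => p + t *: v) f s) //=; last exact: df.
  by rewrite diff_val /L scale1r.
have sub s : s \in `]0 : R, 1[ -> s \in `[0 : R, 1].
  by rewrite !in_itv /= => /andP[/ltW -> /ltW ->].
have [|s s01] := @MVT R h (fun s => 'D_v f (p + s *: v)) 0 1 ltr01
   (fun s s01 => dh s (sub s s01)).
  apply: derivable_within_continuous => s s01; exact: (@ex_derive _ _ _ _ _ _ _ (dh s s01)).
by rewrite subr0 mulr1 /h scale1r scale0r addr0 => E; exists s.
Qed.

(* Young's theorem: both mixed derivatives are the limit of
   s^-2 (f(p+sv+sw) - f(p+sv) - f(p+sw) + f(p)). *)
Lemma second_difference (f : V -> R) (A : set V) (p v w : V) : open A -> A p ->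
    smooth_on A f ->
  forall e : R, 0 < e -> \forall s \near (0 : R)^'+,
    `|f (p + s *: v + s *: w) - f (p + s *: v) - f (p + s *: w) + f p
      - s ^+ 2 * 'D_w (fun x => 'D_v f x) p| <= e * s ^+ 2.
Proof.
move=> oA Ap sf e e0.
have dDf : differentiable (fun x => 'D_v f x) p.
  exact: smooth_on_differentiable (smooth_on_derive v sf) Ap.
(* Twice the bound [|v| + |w|], one for each of the two points where ['D_v f] is compared with its
   value at [p]; the final 1 keeps [C] positive. *)
pose C := `|v| + `|w| + (`|v| + `|w|) + 1.
have C0 : 0 < C by rewrite ltr_wpDl // !addr_ge0.
have e'0 : 0 < e / C by rewrite divr_gt0.
have nA : nbhs p A by exact: open_nbhs_nbhs.
have : nbhs p (A `&` [set y | `|'D_v f y - 'D_v f p -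
    'd (fun x => 'D_v f x) p (y - p)| <= e / C * `|y - p|]).
  by apply: filterI => //; exact: diff_near_le.
move=> /nbhs_ballP[d /= d0 Hd].
near=> s.
have s0 : 0 < s by near: s; exact: nbhs_right_gt.
have sd : s * C < d.
  rewrite -ltr_pdivlMr //; near: s; apply: nbhs_right_lt; exact: divr_gt0.
have inball (a b : R) : a \in `[0 : R, 1] -> b \in `[0 : R, 1] ->
    ball p d (p + a *: (s *: v) + b *: (s *: w)) /\
    `|a *: (s *: v) + b *: (s *: w)| <= s * (`|v| + `|w|).
  rewrite !in_itv /= => /andP[a0 a1] /andP[b0 b1].
  have N : `|a *: (s *: v) + b *: (s *: w)| <= s * (`|v| + `|w|).
    apply: (le_trans (ler_normD _ _)); rewrite !normrZ.
    rewrite (ger0_norm a0) (ger0_norm b0) (ger0_norm (ltW s0)) mulrDr.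
    apply: lerD; rewrite ler_piMl // mulr_ge0 //; exact: ltW.
  split=> //; rewrite -ball_normE /= -addrA opprD addrA subrr sub0r normrN.
  apply: le_lt_trans N _; apply: le_lt_trans sd; rewrite ler_wpM2l ?(ltW s0) //.
  by rewrite /C -addrA lerDl addr_ge0 // addr_ge0.
(* The second difference is the increment of [F] along [s *: v]. One mean value turns it into an
   increment of ['D_v f] along [s *: w], which the differentiability of ['D_v f] at [p]
   evaluates. *)
pose F x := f (x + s *: w) - f x.
have i01 (a : R) : a \in `]0 : R, 1[ -> a \in `[0 : R, 1].
  by rewrite !in_itv /= => /andP[/ltW -> /ltW ->].
have I0 : (0 : R) \in `[0 : R, 1] by rewrite in_itv /= lexx ler01.
have I1 : (1 : R) \in `[0 : R, 1] by rewrite in_itv /= lexx ler01.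
have dfa a b : a \in `[0 : R, 1] -> b \in `[0 : R, 1] ->
    differentiable f (p + a *: (s *: v) + b *: (s *: w)).
  by move=> ha hb; have [/Hd [Aq _] _] := inball a b ha hb;
    exact: smooth_on_differentiable sf Aq.
have dshift x : differentiable (fun y : V => y + s *: w) x.
  by have -> : (fun y : V => y + s *: w) = id + cst (s *: w) by []; exact: differentiableD.
have dF a : a \in `[0 : R, 1] -> differentiable F (p + a *: (s *: v)).
  move=> ha; have := dfa a 1 ha I1; have := dfa a 0 ha I0.
  rewrite scale0r addr0 scale1r => d1 d2.
  rewrite (_ : F = (f \o (fun x => x + s *: w)) - f) //.
  apply: differentiableB => //.
  by apply: (@differentiable_comp _ _ _ _ (fun x => x + s *: w) f).
have [a ha] := mean_value dF.
have := i01 _ ha => {}ha.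
rewrite {1 2}/F.
have -> : 'D_(s *: v) F (p + a *: (s *: v)) =
   s * ('D_v f (p + a *: (s *: v) + s *: w) - 'D_v f (p + a *: (s *: v))).
  have := dfa a 1 ha I1; have := dfa a 0 ha I0.
  rewrite scale0r addr0 scale1r => d1 d2.
  have d3 : differentiable (f \o (fun x => x + s *: w)) (p + a *: (s *: v)).
    exact: differentiable_comp.
  have -> : F = (f \o (fun x => x + s *: w)) - f by [].
  rewrite deriveB; [|exact: diff_derivable|exact: diff_derivable].
  rewrite !deriveE // diff_comp //=.
  have -> : 'd (fun x : V => x + s *: w) (p + a *: (s *: v)) (s *: v) = s *: v.
    have -> : (fun y : V => y + s *: w) = id + cst (s *: w) by [].
    by rewrite diffD // diff_val diff_cst /= addr0.
  by rewrite mulrBr; congr (_ - _); rewrite linearZ.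
move=> E.
have {E}-> : f (p + s *: v + s *: w) - f (p + s *: v) - f (p + s *: w) + f p =
   s * ('D_v f (p + a *: (s *: v) + s *: w) - 'D_v f (p + a *: (s *: v))).
  by rewrite -E opprB; ring.
have [/Hd [_ /=]] := inball a 0 ha I0; have [/Hd [_ /=]] := inball a 1 ha I1.
rewrite scale1r scale0r !addr0.
set q1 := p + _ + _; set q0 := p + a *: _ => h1 n1 h0 n0.
set D := 'd (fun x => 'D_v f x) p in h1 h0 *.
rewrite [X in s ^+ 2 * X]deriveE // -/D.
have -> : s * ('D_v f q1 - 'D_v f q0) - s ^+ 2 * D w =
  s * (('D_v f q1 - 'D_v f p - D (q1 - p)) - ('D_v f q0 - 'D_v f p - D (q0 - p))).
  have -> : D (q1 - p) = D (q0 - p) + s * D w.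
    by rewrite -[s * D w]/(s *: D w) -linearZ -linearD /q1 addrAC.
  ring.
rewrite normrM (gtr0_norm s0).
have q1p : q1 - p = a *: (s *: v) + s *: w by rewrite /q1 addrAC (addrAC p) subrr add0r.
have q0p : q0 - p = a *: (s *: v) by rewrite /q0 addrAC subrr add0r.
rewrite -q1p in n1; rewrite -q0p in n0.
have : `|('D_v f q1 - 'D_v f p - D (q1 - p)) - ('D_v f q0 - 'D_v f p - D (q0 - p))|
   <= e * s.
  apply: (le_trans (ler_normB _ _)).
  apply: (le_trans (lerD h1 h0)); rewrite -mulrDr.
  have le2 : `|q1 - p| + `|q0 - p| <= s * C.
    apply: (le_trans (lerD n1 n0)); rewrite -mulrDr.
    by rewrite ler_wpM2l ?(ltW s0) // /C lerDl.
  apply: (le_trans (ler_wpM2l (ltW e'0) le2)).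
  by rewrite mulrCA divfK ?gt_eqF // mulrC.
by move=> h; rewrite expr2 mulrCA ler_wpM2l ?(ltW s0).
Unshelve. all: by end_near. Qed.

Lemma mixed_derivative_real (f : V -> R) (A : set V) (p v w : V) : open A -> A p ->
    smooth_on A f ->
  'D_w (fun x => 'D_v f x) p = 'D_v (fun x => 'D_w f x) p.
Proof.
move=> oA Ap sf; set a := LHS; set b := RHS.
apply/subr0_eq/normr0_eq0/eqP; rewrite eq_le normr_ge0 andbT.
apply/ler_addgt0Pr => e e0; rewrite add0r.
have e20 : 0 < e / 2 by rewrite divr_gt0.
have h1 := second_difference v w oA Ap sf e20.
have h2 := second_difference w v oA Ap sf e20.
have [s [[/= k1 k2] s0]] := filter_ex (filterI (filterI h1 h2) (@nbhs_right_gt R 0)).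
rewrite (addrAC p (s *: w)) -/b in k2; rewrite -/a in k1.
rewrite -(ler_pM2l (exprn_gt0 2 s0)) -[X in X * `|_|](gtr0_norm (exprn_gt0 2 s0)).
rewrite -normrM mulrBr -/a -/b.
set D := f (p + _ + _) in k1 k2.
have -> : s ^+ 2 * a - s ^+ 2 * b =
  (D - f (p + s *: w) - f (p + s *: v) + f p - s ^+ 2 * b) -
  (D - f (p + s *: v) - f (p + s *: w) + f p - s ^+ 2 * a) by ring.
apply: (le_trans (ler_normB _ _)); apply: (le_trans (lerD k2 k1)).
by rewrite -mulrDl -splitr mulrC.
Qed.


End MeanValue.

Section MatrixEntries.
Context {R : realType}.

Lemma entry_le_norm m n (A : 'M[R]_(m, n)) i j : `|A i j| <= `|A|.
Proof.
rewrite [leRHS]/Num.Def.normr /= mx_normrE.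
exact: (le_bigmax _ (fun ij : 'I_m * 'I_n => `|A ij.1 ij.2|) (i, j)).
Qed.

Lemma norm_le_entries m n (A : 'M[R]_(m, n)) (C : R) : 0 <= C ->
  (forall i j, `|A i j| <= C) -> `|A| <= C.
Proof.
by move=> C0 h; rewrite /Num.Def.normr /= mx_normrE bigmax_le // => -[i j] _; exact: h.
Qed.

Lemma cvg_entries (T : Type) (F : set_system T) (FF : Filter F) m n
    (u : T -> 'M[R]_(m, n)) (l : 'M[R]_(m, n)) :
  (forall i j, (fun t => u t i j) @ F --> l i j) -> u @ F --> l.
Proof.
move=> h; apply/cvgrPdist_le => e e0.
have N : F [set t | forall ij : 'I_m * 'I_n, `|l ij.1 ij.2 - u t ij.1 ij.2| <= e].
  by apply: filter_forall => -[i j] /=; have /cvgrPdist_le := h i j; exact.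
apply: filterS N => t ht; apply: norm_le_entries (ltW e0) _ => i j.
by rewrite !mxE; exact: ht (i, j).
Qed.

(** Each entry is a telescoping series dominated by [v], hence absolutely convergent. This serves
    both the iterates of the doubling map and the exponential series. *)
Lemma cvg_summable_increments m n (u : nat -> 'M[R]_(m, n)) (v : nat -> R) :
  (forall k, `|u k.+1 - u k| <= v k) -> cvgn (series v) -> cvgn u.
Proof.
move=> uv cv.
have ent i j : cvgn (fun k => u k i j : R).
  pose w k : R := u k i j.
  have : cvgn (series (telescope w)).
    apply: normed_cvg; apply: series_le_cvg cv => [k|k|].
    - exact: normr_ge0.
    - by apply: le_trans (uv k); exact: normr_ge0.
    - move=> k; apply: le_trans (uv k); rewrite /telescope /w.
    by have := entry_le_norm (u k.+1 - u k) i j; rewrite !mxE.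
  rewrite telescopeK => c.
  have -> : (fun k => u k i j : R) = [sequence w n - w 0%N]_n + cst (w 0%N).
    by apply/funext => k; rewrite /= /w [RHS]/GRing.add /= subrK.
  by apply: is_cvgD => //; exact: is_cvg_cst.
apply/cvg_ex; exists (\matrix_(i, j) limn (fun k => u k i j : R)).
by apply: cvg_entries => i j; rewrite mxE; exact: ent.
Qed.

End MatrixEntries.

Section CoordinateFunctions.
Context {R : realType} {V : normedModType R} {n : nat}.
Implicit Types (f : V -> 'rV[R]_n) (A : set V).

Lemma smooth_entry f A i : open A -> smooth_on A f -> smooth_on A (fun x => f x 0 i).
Proof.
move=> oA sf k; elim: k f {sf}(sf k) => [|k IH] f /=.
  move=> fc x Ax.
  apply: (@continuous_comp _ _ _ f (fun v : 'rV[R]_n => v 0 i)); first exact: fc.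
  exact: coord_continuous.
move=> [df Df]; split=> [x Ax|v].
  apply: (@differentiable_comp _ _ _ _ f (fun v : 'rV[R]_n => v 0 i)); first exact: df.
  exact: differentiable_coord.
apply: Ck_on_eq (IH _ (Df v)) => // x Ax.
by rewrite derive_mx ?mxE //; exact/diff_derivable/df.
Qed.

Lemma mixed_derivative f A (p v w : V) : open A -> A p -> smooth_on A f ->
  'D_w (fun x => 'D_v f x) p = 'D_v (fun x => 'D_w f x) p.
Proof.
move=> oA Ap sf; apply/rowP => i.
have nA : nbhs p A by exact: open_nbhs_nbhs.
have D u u' : ('D_u (fun x => 'D_u' f x) p) 0 i =
    'D_u (fun x => 'D_u' (fun y => f y 0 i) x) p.
  rewrite derive_mx ?mxE; last first.
    apply: diff_derivable.
    exact: smooth_on_differentiable (smooth_on_derive _ sf) Ap.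
  apply: near_eq_derive; apply: filterS nA => x Ax.
  rewrite derive_mx ?mxE //; apply: diff_derivable.
  exact: smooth_on_differentiable sf Ax.
have E := mixed_derivative_real v w oA Ap (smooth_entry i oA sf).
exact: (etrans (D w v) (etrans E (esym (D v w)))).
Qed.

End CoordinateFunctions.

(** * Quadratic Taylor remainders *)

Section QuadraticRemainder.
Context {R : realType} {n m : nat}.

Lemma differentiable_lipschitz_at (V W : normedModType R) (g : V -> W) (p : V) :
  differentiable g p ->
  exists K : R, 0 <= K /\ \forall x \near p, `|g x - g p| <= K * `|x - p|.
Proof.
move=> dg; have [k k0 hk] := linear_lipschitz (diff_continuous dg).
exists (k + 1); split; first by rewrite addr_ge0 // ltW.
apply: filterS (diff_near_le dg ltr01) => x hx.
rewrite -[g x - g p](subrK ('d g p (x - p))) mulrDl addrC.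
by apply: le_trans (ler_normD _ _) _; exact: lerD.
Qed.

(** Partial derivatives, being differentiable, are Lipschitz at [p]; the mean value theorem on the
    segment from [y] to [x] integrates this entry by entry. The radius [M] stays separate from [r]
    so that the Lipschitz constant [K * M] of the remainder shrinks with the points. *)
Lemma quadratic_remainder (f : 'rV[R]_n -> 'rV[R]_m) (A : set 'rV[R]_n) p :
    open A -> A p -> smooth_on A f ->
  exists K r : R, [/\ 0 <= K, 0 < r, forall x, `|x - p| < r -> A x &
    forall x y M, `|x - p| < r -> `|y - p| < r -> `|x - p| <= M -> `|y - p| <= M ->
      `|f x - f y - 'd f p (x - y)| <= K * M * `|x - y|].
Proof.
move=> oA Ap sf.
pose e (l : 'I_n) : 'rV[R]_n := delta_mx 0 l.
have dD l : differentiable (fun x => 'D_(e l) f x) p.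
  exact: smooth_on_differentiable (smooth_on_derive _ sf) Ap.
have [K hK] := choice (fun l => differentiable_lipschitz_at (dD l)).
have K0 l : 0 <= K l by have [] := hK l.
have N : nbhs p (A `&` [set x | forall l : 'I_n,
    `|'D_(e l) f x - 'D_(e l) f p| <= K l * `|x - p|]).
  apply: filterI; first exact: open_nbhs_nbhs.
  have hn (l : 'I_n) : \forall x \near p,
    `|'D_(e l) f x - 'D_(e l) f p| <= K l * `|x - p| by have [] := hK l.
  exact: (filter_forall _ hn).
have /nbhs_ballP[r /= r0 Hr] := N.
have inr x : `|x - p| < r -> A x /\
    forall l, `|'D_(e l) f x - 'D_(e l) f p| <= K l * `|x - p|.
  by move=> xr; apply: Hr; rewrite -ball_normE /= distrC.
exists (\sum_l K l), r; split=> //; first by apply: sumr_ge0 => l _.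
  by move=> x /inr[].
move=> x y M xr yr xM yM.
have M0 : 0 <= M by exact: le_trans (normr_ge0 _) xM.
have seg (s : R) : s \in `[0 : R, 1] -> `|y + s *: (x - y) - p| < r /\
    `|y + s *: (x - y) - p| <= M.
  rewrite in_itv /= => /andP[s0 s1].
  have -> : y + s *: (x - y) - p = (1 - s) *: (y - p) + s *: (x - p).
    apply/rowP => i; rewrite !mxE; ring.
  have s1' : 0 <= 1 - s by rewrite subr_ge0.
  have B C : 0 <= C -> `|y - p| <= C -> `|x - p| <= C ->
      `|(1 - s) *: (y - p) + s *: (x - p)| <= C.
    move=> C0 yC xC; apply: le_trans (ler_normD _ _) _; rewrite !normrZ.
    rewrite (ger0_norm s0) (ger0_norm s1').
    rewrite -[leRHS]mul1r -[X in X * C](subrK s) [leRHS]mulrDl.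
    by apply: lerD; exact: ler_wpM2l.
  split; last exact: B.
  (* Convexity gives only a weak inequality; strictness comes from taking the larger of the two
     norms as [C]. *)
  have [le|le] := leP `|y - p| `|x - p|.
    by apply: le_lt_trans xr; exact: B.
  by apply: le_lt_trans yr; apply: B => //; exact: ltW.
apply: norm_le_entries => [|i j]; first by rewrite !mulr_ge0 // sumr_ge0.
rewrite !ord1 {i}.
have sfj := smooth_entry j oA sf.
have df z : `|z - p| < r -> differentiable (fun x => f x 0 j) z.
  by move=> /inr[Az _]; exact: smooth_on_differentiable sfj Az.
have [s s01] := @mean_value _ _ (fun x => f x 0 j) y (x - y)
   (fun s s01 => df _ (seg s s01).1).
have {}s01 : s \in `[0 : R, 1].
  by move: s01; rewrite !in_itv /= => /andP[/ltW -> /ltW ->].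
have [zr zM] := seg s s01.
set z := y + _ in zr zM *.
have [Az hz] := inr z zr.
rewrite [y + _]addrC subrK => E.
have dfz : differentiable f z by exact: smooth_on_differentiable sf Az.
have dfp : differentiable f p by exact: smooth_on_differentiable sf Ap.
rewrite !mxE {}E.
have lin q : differentiable f q ->
    ('d f q (x - y)) 0 j = \sum_l (x - y) 0 l * ('D_(e l) f q) 0 j.
  move=> dfq; rewrite {1}[x - y]row_sum_delta linear_sum summxE; apply: eq_bigr => l _.
  by rewrite linearZ deriveE // [LHS]mxE.
have -> : 'D_(x - y) (fun x => f x 0 j) z = \sum_l (x - y) 0 l * ('D_(e l) f z) 0 j.
  transitivity (('D_(x - y) f z) 0 j); last by rewrite deriveE //; exact: lin.
  by rewrite derive_mx ?mxE //; exact: diff_derivable.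
rewrite (lin p dfp) -sumrB.
apply: le_trans (ler_norm_sum _ _ _) _.
rewrite -mulrA mulr_suml; apply: ler_sum => l _.
rewrite -mulrBr normrM mulrC mulrA.
apply: ler_pM => //; last exact: entry_le_norm.
have := entry_le_norm ('D_(e l) f z - 'D_(e l) f p) 0 j; rewrite !mxE.
move=> /le_trans; apply; apply: le_trans (hz l) _.
by rewrite ler_wpM2l.
Qed.

End QuadraticRemainder.

(** * Linearization of a map with derivative 2 *)

Section DoublingMap.
Context {R : realType} {n : nat}.
Local Notation V := 'rV[R]_n.
Local Notation h := (fun j : nat => 2^-1 ^+ j : R).

(** On points of size [2^-j] the expansion factor [2 + K * M] differs from 2 by a summable amount;
    this controls infinitely many iterations. *)
Definition nearly_doubling (phi : V -> V) (K r : R) :=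
  [/\ 0 <= K, 0 < r, phi 0 = 0 &
    forall x y M, `|x| < r -> `|y| < r -> `|x| <= M -> `|y| <= M ->
      `|phi x - phi y - 2 *: (x - y)| <= K * M * `|x - y|].

Variables (phi : V -> V) (K r : R).
Hypothesis dbl : nearly_doubling phi K r.

Let h_gt0 j : 0 < h j. Proof. by rewrite exprn_gt0. Qed.
Let hS j : h j.+1 = h j / 2. Proof. by rewrite /= exprSr. Qed.
Let h2 j : 2 ^+ j * h j = 1. Proof. by rewrite /= -exprMn divff ?expr1n. Qed.
Let h_cvg0 : h @ \oo --> (0 : R).
Proof. by apply: cvg_expr; rewrite ger0_norm // invf_lt1 // ltr1n. Qed.

Let h_small (C e : R) : 0 < e -> \forall j \near \oo, C * h j < e.
Proof.
move=> e0; have : (fun j => C * h j) @ \oo --> C * 0.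
  by apply: cvgM; [exact: cvg_cst|exact: h_cvg0].
rewrite mulr0 => /cvgrPdist_lt/(_ e e0); apply: filterS => j.
by rewrite sub0r normrN; exact: le_lt_trans (ler_norm _).
Qed.

Let lip x y M : `|x| < r -> `|y| < r -> `|x| <= M -> `|y| <= M ->
  `|phi x - phi y| <= (2 + K * M) * `|x - y|.
Proof.
move=> xr yr xM yM; have [_ _ _ /(_ x y M xr yr xM yM) H] := dbl.
rewrite -[phi x - phi y](subrK (2 *: (x - y))) mulrDl [leRHS]addrC.
apply: le_trans (ler_normD _ _) _; apply: lerD => //.
by rewrite normrZ ger0_norm.
Qed.

(** The rescaled distance [d j] of the two sequences tends to 0, as they have the same velocity, but
    it can hardly decrease with [j]: [d j <= (1 + kap * h j.+1) * d j.+1], where the factors have a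
    finite product. So it vanishes. *)
Lemma dyadic_root_unique (a a' : nat -> V) (b : V) :
    (\forall j \near \oo, phi (a j.+1) = a j) ->
    (\forall j \near \oo, phi (a' j.+1) = a' j) ->
    (fun j => 2 ^+ j *: a j) @ \oo --> b -> (fun j => 2 ^+ j *: a' j) @ \oo --> b ->
  \forall j \near \oo, a j = a' j.
Proof.
have [K0 r0 _ _] := dbl.
move=> pa pa' ab a'b; pose C := `|b| + 1; pose kap := K * C / 2.
have bC : `|b| < C by rewrite ltrDl.
have C0 : 0 < C by exact: le_lt_trans bC.
have kap0 : 0 <= kap by rewrite divr_ge0 // mulr_ge0 // ltW.
have bnd (u : nat -> V) j : `|2 ^+ j *: u j| <= C -> `|u j| <= C * h j.
  move=> uC; have -> : u j = h j *: (2 ^+ j *: u j) by rewrite scalerA mulrC h2 scale1r.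
  by rewrite normrZ gtr0_norm // mulrC ler_wpM2r // ltW.
have N : \forall j \near \oo, [/\ phi (a j.+1) = a j, phi (a' j.+1) = a' j,
    `|a j| <= C * h j /\ `|a' j| <= C * h j, C * h j < r & kap * h j < 1].
  have n1 : \forall j \near \oo, `|2 ^+ j *: a j| <= C by have /cvgr_norm_le := ab; exact.
  have n2 : \forall j \near \oo, `|2 ^+ j *: a' j| <= C by have /cvgr_norm_le := a'b; exact.
  have n3 := h_small C r0; have n4 := h_small kap ltr01.
  near=> j; split; last 2 first.
  - by near: j; exact: n3.
  - by near: j; exact: n4.
  - by near: j; exact: pa.
  - by near: j; exact: pa'.
  - by split; apply: bnd; near: j; [exact: n1|exact: n2].
have [j0 _ Hj] := N.
(* The weight absorbs these factors: with [t = kap * h j.+1] and [h j = 2 * h j.+1], one has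
   [(1 - 2t)(1 + t) <= 1 - t], so [e] is nondecreasing. *)
pose d j := 2 ^+ j * `|a j - a' j|; pose e j := (1 - kap * h j) * d j.
have step j : (j0 <= j)%N -> e j <= e j.+1.
  move=> jj; have [p1 p2 _ _ kj] := Hj j jj.
  have [_ _ [b1 b2] rj kj1] := Hj j.+1 (leqW jj).
  have dj : d j <= (1 + kap * h j.+1) * d j.+1.
    have := lip (le_lt_trans b1 rj) (le_lt_trans b2 rj) b1 b2.
    rewrite p1 p2 /d => /(ler_wpM2l (exprn_ge0 j (ler0n R 2))).
    move=> /le_trans; apply; rewrite (exprS 2 j) /kap le_eqVlt; apply/orP; left.
    by move: (h j.+1) (2 ^+ j) => hj tj; apply/eqP; field.
  have k1 : 0 <= 1 - kap * h j by rewrite subr_ge0 ltW.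
  apply: le_trans (ler_wpM2l k1 dj) _; rewrite mulrA ler_wpM2r //.
    by rewrite mulr_ge0 ?exprn_ge0.
  have -> : h j = 2 * h j.+1 by rewrite hS mulrC divfK.
  rewrite -subr_ge0.
  have -> : 1 - kap * h j.+1 - (1 - kap * (2 * h j.+1)) * (1 + kap * h j.+1) =
     2 * (kap * h j.+1) ^+ 2 by ring.
  by rewrite mulr_ge0 // sqr_ge0.
have emono i k : (j0 <= i)%N -> e i <= e (i + k)%N.
  move=> ji; elim: k => [|k IH]; first by rewrite addn0.
  by apply: le_trans IH _; rewrite addnS step // (leq_trans ji) // leq_addr.
have d0 : d @ \oo --> (0 : R).
  have : (fun j => 2 ^+ j *: a j - 2 ^+ j *: a' j) @ \oo --> b - b by exact: cvgB.
  rewrite subrr => /cvg_norm; rewrite normr0.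
  apply: cvg_trans; apply: near_eq_cvg; apply: nearW => j.
  by rewrite -scalerBr normrZ ger0_norm // exprn_ge0.
have e0 : e @ \oo --> (0 : R).
  rewrite -(mulr0 (1 - kap * 0)); apply: cvgM d0.
  by apply: cvgB; [exact: cvg_cst|apply: cvgM; [exact: cvg_cst|exact: h_cvg0]].
exists j0 => // j jj; apply/subr0_eq/normr0_eq0/eqP; rewrite eq_le normr_ge0 andbT.
have [_ _ _ _ kj] := Hj j jj.
have : e j <= 0.
  apply: cvgr_to_ge e0 _; exists j => // k /= jk.
  by rewrite -(subnKC jk); exact: emono.
by rewrite /e /d pmulr_rle0 ?subr_gt0 // pmulr_rle0 // exprn_gt0.
Unshelve. all: by end_near. Qed.

(** [h j *: y j k] is the [k]-th iterate of [phi] at [h (j + k) *: b], and its limit in [k] is the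
    root [a j], just as exp(b) is the limit of (1 + b/2^k)^(2^k). Rescaling by [2 ^+ j] keeps all
    the [y j k] near [b]. *)
Lemma dyadic_root_exists (b : V) : exists (j0 : nat) (a : nat -> V),
  [/\ forall j, (j0 <= j)%N -> phi (a j.+1) = a j /\ `|a j| < r &
      (fun j => 2 ^+ j *: a j) @ \oo --> b].
Proof.
have [K0 r0 phi0 Hphi] := dbl.
pose C := `|b| + 1; pose D := K * C ^+ 2.
have C1 : 1 <= C by rewrite lerDr.
have C0 : 0 < C by exact: lt_le_trans C1.
have D0 : 0 <= D by rewrite mulr_ge0 // exprn_ge0 // ltW.
have N : \forall j \near \oo, [/\ C * h j < r, D * h j <= 1 & K * C * h j <= 1].
  have n1 := h_small C r0; have n2 := h_small D ltr01.
  have n3 := h_small (K * C) ltr01.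
  near=> j; split; first by near: j; exact: n1.
    by apply/ltW; near: j; exact: n2.
  by apply/ltW; near: j; exact: n3.
have [j0 _ Hj] := N.
pose fix y j k := if k is k'.+1 then 2 ^+ j *: phi (h j.+1 *: y j.+1 k') else b.
have small j k : (j0 <= j)%N -> `|y j k| <= C -> `|h j *: y j k| <= C * h j.
  by move=> jj yC; rewrite normrZ gtr0_norm // mulrC ler_wpM2r // ltW.
(* The remainder of [phi] contributes [D * h j / 4] and the induction hypothesis at [j.+1]
   contributes [D * h j / 2], so the bound reproduces itself; this is why [D] is [K * C ^+ 2]. *)
have yb k : forall j, (j0 <= j)%N -> `|y j k - b| <= D * h j /\ `|y j k| <= C.
  elim: k => [|k IH] j jj.
    by rewrite /= subrr normr0 mulr_ge0 ?lerDl // ltW.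
  have [r1 D1 KC1] := Hj j jj; have [r1' _ _] := Hj j.+1 (leqW jj).
  have [IH1 IH2] := IH j.+1 (leqW jj).
  suff S : `|y j k.+1 - b| <= D * h j.
    split=> //; rewrite -[y j k.+1](subrK b) /C addrC; apply: le_trans (ler_normD _ _) _.
    by rewrite lerD2l; exact: le_trans S D1.
  have sm := small _ _ (leqW jj) IH2.
  have sr := le_lt_trans sm r1'.
  have := Hphi (h j.+1 *: y j.+1 k) 0 _ sr _ sm.
  rewrite normr0 => /(_ r0 _)/[dup] _.
  have -> : y j k.+1 - b = 2 ^+ j *: (phi (h j.+1 *: y j.+1 k) - phi 0 -
      2 *: (h j.+1 *: y j.+1 k - 0)) + (y j.+1 k - b).
    rewrite phi0 !subr0 scalerBr [y j k.+1]/= addrA; congr (_ - b).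
    by rewrite (scalerA _ 2) -exprSr scalerA h2 scale1r subrK.
  move=> /(_ (mulr_ge0 (ltW C0) (ltW (h_gt0 _)))); rewrite subr0 => H.
  apply: le_trans (ler_normD _ _) _; rewrite normrZ ger0_norm ?exprn_ge0 //.
  have H' : `|phi (h j.+1 *: y j.+1 k) - phi 0 - 2 *: (h j.+1 *: y j.+1 k)| <=
      D * h j.+1 ^+ 2.
    apply: le_trans H _.
    have -> : D * h j.+1 ^+ 2 = K * (C * h j.+1) * (C * h j.+1) by rewrite /D; ring.
    by rewrite ler_wpM2l // mulr_ge0 // mulr_ge0 // ltW.
  apply: le_trans (lerD (ler_wpM2l (exprn_ge0 j (ler0n R 2)) H') IH1) _.
  have -> : 2 ^+ j * (D * h j.+1 ^+ 2) + D * h j.+1 =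
     (2 ^+ j * h j) * (D * h j / 4) + D * h j / 2 by rewrite hS; field.
  rewrite h2 mul1r.
  have : 0 <= D * h j by rewrite mulr_ge0 // ltW.
  by move=> ?; lra.
(* One more iteration costs a factor [(2 + K * C * h j.+1) / 2 <= 3 / 2], while the bound at [j.+1]
   is half the bound at [j]: together [3 / 4]. *)
have dy k : forall j, (j0 <= j)%N ->
    `|y j k.+1 - y j k| <= D * h j * (3 / 4) ^+ k.
  elim: k => [|k IH] j jj; first by rewrite expr0 mulr1; exact: (yb 1%N j jj).1.
  have [r1 _ KC1] := Hj j.+1 (leqW jj).
  have s1 := small _ _ (leqW jj) (yb k.+1 j.+1 (leqW jj)).2.
  have s0 := small _ _ (leqW jj) (yb k j.+1 (leqW jj)).2.
  have := lip (le_lt_trans s1 r1) (le_lt_trans s0 r1) s1 s0.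
  rewrite -scalerBr normrZ gtr0_norm // => L.
  have -> : y j k.+2 - y j k.+1 =
     2 ^+ j *: (phi (h j.+1 *: y j.+1 k.+1) - phi (h j.+1 *: y j.+1 k)).
    by rewrite scalerBr.
  rewrite normrZ ger0_norm ?exprn_ge0 //.
  apply: le_trans (ler_wpM2l (exprn_ge0 j (ler0n R 2)) L) _.
  have IHj := IH j.+1 (leqW jj).
  rewrite mulrCA (mulrA (2 ^+ j)) hS (mulrA (2 ^+ j)) h2 mul1r mulrA.
  have q : 0 <= (2 + K * (C * (h j / 2))) * 2^-1.
    by rewrite divr_ge0 // addr_ge0 // mulr_ge0 // mulr_ge0 ?divr_ge0 // ltW.
  apply: le_trans (ler_wpM2l q IHj) _; rewrite hS.
  have q2 : (2 + K * (C * (h j / 2))) * 2^-1 <= 3 / 2.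
    by move: KC1; rewrite -mulrA hS => KC1; lra.
  apply: le_trans (ler_wpM2r _ q2) _.
    by rewrite mulr_ge0 // ?exprn_ge0 ?divr_ge0 // mulr_ge0 // ltW.
  by rewrite exprS le_eqVlt; apply/orP; left; apply/eqP; field.
have cy j : (j0 <= j)%N -> cvgn (y j).
  move=> jj; apply: (@cvg_summable_increments _ _ _ (y j) (geometric (D * h j) (3 / 4))).
    by move=> k; exact: dy.
  apply: is_cvg_geometric_series; rewrite ger0_norm ?divr_ge0 //; lra.
pose Y j := limn (y j).
have Yb j : (j0 <= j)%N -> `|Y j - b| <= D * h j.
  move=> jj.
  have L : (fun k => `|y j k - b|) @ \oo --> `|Y j - b|.
    by apply: cvg_norm; apply: cvgB; [exact: cy|exact: cvg_cst].
  by apply: cvgr_to_le L _; apply: nearW => k; exact: (yb k j jj).1.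
have YC j : (j0 <= j)%N -> `|Y j| <= C.
  move=> jj; have L : (fun k => `|y j k|) @ \oo --> `|Y j|.
    by apply: cvg_norm; exact: cy.
  by apply: cvgr_to_le L _; apply: nearW => k; exact: (yb k j jj).2.
exists j0, (fun j => h j *: Y j); split.
  move=> j jj; have [r1 _ _] := Hj j jj; have [r2 _ _] := Hj j.+1 (leqW jj).
  have nY i : (j0 <= i)%N -> `|h i *: Y i| <= C * h i.
    by move=> ii; rewrite normrZ gtr0_norm // mulrC ler_wpM2r ?YC // ltW.
  split; last exact: le_lt_trans (nY j jj) r1.
  have L1 : (fun k => h j *: y j k.+1) @ \oo --> h j *: Y j.
    apply: cvgZl_tmp.
    by have := cy j jj; rewrite -(cvg_shiftS (y j)).
  have L2 : (fun k => h j *: y j k.+1) @ \oo --> phi (h j.+1 *: Y j.+1).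
    have Ly : (fun k => h j.+1 *: y j.+1 k) @ \oo --> h j.+1 *: Y j.+1.
      by apply: cvgZl_tmp; exact: cy (leqW jj).
    have -> : (fun k => h j *: y j k.+1) = (fun k => phi (h j.+1 *: y j.+1 k)).
      by apply/funext => k; rewrite /= scalerA mulrC h2 scale1r.
    have L0 : (fun k => (2 + K * (C * h j.+1)) *
        `|h j.+1 *: Y j.+1 - h j.+1 *: y j.+1 k|) @ \oo --> (0 : R).
      rewrite -(mulr0 (2 + K * (C * h j.+1))); apply: cvgM; first exact: cvg_cst.
      rewrite -(@normr0 _ V) -(subrr (h j.+1 *: Y j.+1)).
      by apply: cvg_norm; apply: cvgB => //; exact: cvg_cst.
    apply/cvgrPdist_lt => e e0.
    move/cvgrPdist_lt : L0 => /(_ e e0); apply: filterS => k.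
    rewrite sub0r normrN => /(le_lt_trans (ler_norm _)); apply: le_lt_trans.
    have s1 := small _ _ (leqW jj) (yb k j.+1 (leqW jj)).2.
    have s2 := nY _ (leqW jj).
    by apply: lip => //; [exact: le_lt_trans s2 r2|exact: le_lt_trans s1 r2].
  exact: (cvg_unique _ L2 L1).
apply/cvgrPdist_le => e e0.
have n1 := h_small D e0; near=> j.
rewrite scalerA h2 scale1r distrC; apply: le_trans (Yb j _) _.
  by near: j; exact: nbhs_infty_ge.
by apply/ltW; near: j; exact: n1.
Unshelve. all: by end_near. Qed.

End DoublingMap.

(** * Charts and differentials *)

Section Charts.
Context {R : realType} {n : nat} {M : smoothManifoldType R n}.
Implicit Types (u v w : M) (p q x : 'rV[R]_n).

Lemma chart_cod_chart u v : chart_dom u v -> chart_cod u (chart u v).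
Proof. by move=> uv; exists v. Qed.

Lemma chart_cod_self u : chart_cod u (chart u u).
Proof. exact/chart_cod_chart/mem_chart_dom. Qed.

Lemma chart_inv_self u : chart_inv u (chart u u) = u.
Proof. exact/chartK/mem_chart_dom. Qed.

Lemma chart_inv_dom u p : chart_cod u p -> chart_dom u (chart_inv u p).
Proof. by move=> [v uv <-]; rewrite chartK. Qed.

Lemma chart_invK u p : chart_cod u p -> chart u (chart_inv u p) = p.
Proof. by move=> [v uv <-]; rewrite chartK. Qed.

Lemma open_cod u : open (chart_cod u).
Proof. exact: open_chart_cod. Qed.

Lemma near_cod u p : chart_cod u p -> \forall q \near p, chart_cod u q.
Proof. by move=> up; apply: open_nbhs_nbhs; split=> //; exact: open_cod. Qed.

Lemma near_dom v w : chart_dom v w -> \forall w' \near w, chart_dom v w'.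
Proof. by move=> vw; apply: open_nbhs_nbhs; split=> //; exact: open_chart_dom. Qed.

Lemma near_chart_inv u p (S : set M) : chart_cod u p -> nbhs (chart_inv u p) S ->
  \forall q \near p, chart_cod u q /\ S (chart_inv u q).
Proof.
move=> up Sp; apply: filterI; first exact: near_cod.
exact: (chart_inv_continuous _ _ up _ Sp).
Qed.

Definition transition u v p : 'rV[R]_n := chart v (chart_inv u p).

Definition overlap u v : set 'rV[R]_n :=
  [set p | chart_cod u p /\ chart_dom v (chart_inv u p)].

Lemma transition_differentiable u v p : overlap u v p ->
  differentiable (transition u v) p.
Proof.
move=> [up vp]; apply: smooth_on_differentiable (chart_compatible u v) _.
by exists (chart_inv u p); [split=> //; exact: chart_inv_dom|exact: chart_invK].
Qed.

Lemma overlap_center u v : chart_dom v u -> overlap u v (chart u u).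
Proof. by move=> vu; split; [exact: chart_cod_self|rewrite chart_inv_self]. Qed.

Lemma overlap_to u p w : chart_cod u p -> w = chart_inv u p -> overlap u w p.
Proof. by move=> up ->; split=> //; exact: mem_chart_dom. Qed.

Lemma diff_transition_id u p x : chart_cod u p -> 'd (transition u u) p x = x.
Proof.
move=> up; have [] := @near_eq_diff R _ _ id (transition u u) p.
- by apply: filterS (near_cod up) => q uq; rewrite /transition chart_invK.
- by [].
- by move=> _ ->; rewrite diff_val.
Qed.

Lemma diff_transition_comp u v w p x : overlap u v p -> chart_dom w (chart_inv u p) ->
  'd (transition v w) (transition u v p) ('d (transition u v) p x) =
  'd (transition u w) p x.
Proof.
move=> uvp wp; have [up vp] := uvp.
have uwp : overlap v w (transition u v p).
  by split; [exact: chart_cod_chart|rewrite /transition chartK].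
have E : \forall q \near p, transition u w q = transition v w (transition u v q).
  apply: filterS (near_chart_inv up (near_dom vp)) => q [uq vq].
  by rewrite /transition chartK.
have [_ D] := diff_comp_near (transition_differentiable uvp)
  (transition_differentiable uwp) E.
exact: esym (D x).
Qed.

Lemma diff_transitionK u v p x : overlap u v p ->
  'd (transition v u) (transition u v p) ('d (transition u v) p x) = x.
Proof.
move=> uvp; have [up _] := uvp.
by rewrite diff_transition_comp ?diff_transition_id //; exact: chart_inv_dom.
Qed.

End Charts.

Section Differentials.
Context {R : realType}.

Definition mdifferentiable {m n} {M : smoothManifoldType R m}
    {N : smoothManifoldType R n} (f : M -> N) (w : M) : Prop :=
  {for w, continuous f} /\
  differentiable (chart (f w) \o f \o chart_inv w) (chart w w).

(** Tangent vectors at a point are written in that point's own chart, so reading a differential in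
    other charts inserts one transition at each end. This links [mdiff] to smoothness, which is
    stated in fixed charts. *)
Lemma mdiff_charts {m n} {M : smoothManifoldType R m} {N : smoothManifoldType R n}
    (f : M -> N) (w u : M) (v : N) (p : 'rV[R]_m) :
    mdifferentiable f w -> chart_cod u p -> chart_inv u p = w -> chart_dom v (f w) ->
  differentiable (chart v \o f \o chart_inv u) p /\
  forall x, 'd (chart v \o f \o chart_inv u) p x =
    'd (transition (f w) v) (chart (f w) (f w))
       (mdiff f w ('d (transition u w) p x)).
Proof.
move=> [fc fd] up pw vfw.
have uwp : overlap u w p by exact: overlap_to.
have Twp : transition u w p = chart w w by rewrite /transition pw.
have ov : overlap (f w) v (chart (f w) (f w)) by exact: overlap_center.
have d1 := transition_differentiable uwp.
have d2 : differentiable (chart (f w) \o f \o chart_inv w) (transition u w p).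
  by rewrite Twp.
pose F q := chart (f w) (f (chart_inv w (transition u w q))).
have EF : \forall q \near p, F q =
    (chart (f w) \o f \o chart_inv w) (transition u w q) by apply: filterS (near_cod up) => q.
have [d12 D12] := diff_comp_near d1 d2 EF.
have e12 : F p = chart (f w) (f w).
  by rewrite /F Twp chart_inv_self.
have d3 : differentiable (transition (f w) v) (F p).
  by rewrite e12; exact: transition_differentiable.
have nf : \forall q \near p, chart_cod u q /\
    (chart_dom w (chart_inv u q) /\ chart_dom (f w) (f (chart_inv u q))).
  apply: (@near_chart_inv _ _ _ u p
    (chart_dom w `&` [set w' | chart_dom (f w) (f w')])) => //.
  rewrite pw; apply: filterI; first exact/near_dom/mem_chart_dom.
  exact: (fc _ (near_dom (mem_chart_dom (f w)))).
have E : \forall q \near p, (chart v \o f \o chart_inv u) q =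
    transition (f w) v (F q).
  by apply: filterS nf => q [uq [wq fq]]; rewrite /F /transition /= !chartK.
have [dh Dh] := diff_comp_near d12 d3 E.
split=> [|x]; first exact: dh.
have K : 'd F p x = mdiff f w ('d (transition u w) p x).
  have := D12 x.
  rewrite Twp.
  rewrite /mdiff.
  exact.
apply: (etrans (Dh x)); rewrite e12.
exact: (congr1 ('d (transition (f w) v) (chart (f w) (f w))) K).
Qed.

Lemma mdiff_comp {l m n} {M : smoothManifoldType R l} {N : smoothManifoldType R m}
    {P : smoothManifoldType R n} (f : M -> N) (g : N -> P) (w : M) (x : 'rV[R]_l) :
    mdifferentiable f w -> mdifferentiable g (f w) ->
  mdiff (g \o f) w x = mdiff g (f w) (mdiff f w x).
Proof.
move=> [fc fd] [gc gd].
have E : (chart (f w) \o f \o chart_inv w) (chart w w) = chart (f w) (f w).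
  by rewrite /= chart_inv_self.
rewrite -E in gd.
have nf : nbhs (chart_inv w (chart w w)) [set v | chart_dom (f w) (f v)].
  by rewrite chart_inv_self; exact: (fc _ (near_dom (mem_chart_dom (f w)))).
have H : \forall q \near chart w w, (chart (g (f w)) \o (g \o f) \o chart_inv w) q =
    (chart (g (f w)) \o g \o chart_inv (f w)) ((chart (f w) \o f \o chart_inv w) q).
  apply: filterS (near_chart_inv (chart_cod_self w) nf) => q [wq fq].
  by rewrite /= chartK.
have [_ D] := diff_comp_near fd gd H.
apply: (etrans (D x)); rewrite E /mdiff.
reflexivity.
Qed.

Lemma mdiff_near_id {n} {M : smoothManifoldType R n} (f : M -> M) (w : M) x :
  (\forall v \near w, f v = v) -> mdiff f w x = x.
Proof.
move=> fid; have fw := nbhs_singleton fid; rewrite /mdiff fw.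
have h : \forall q \near chart w w, q = (chart w \o f \o chart_inv w) q.
  have nf : nbhs (chart_inv w (chart w w)) [set v | f v = v] by rewrite chart_inv_self.
  apply: filterS (near_chart_inv (chart_cod_self w) nf) => q [wq /= ->].
  by rewrite chart_invK.
have did : differentiable (id : 'rV[R]_n -> 'rV[R]_n) (chart w w) by [].
have [_ D] := near_eq_diff h did.
by apply: (etrans (congr1 (fun F => F x) D)); rewrite diff_val.
Qed.

Lemma smooth_map_on_mdifferentiable {m n} {M : smoothManifoldType R m}
    {N : smoothManifoldType R n} (U : set M) (f : M -> N) (w : M) :
  smooth_map_on U f -> U w -> mdifferentiable f w.
Proof.
move=> [fc fs] Uw; split; first exact: fc.
apply: smooth_on_differentiable (fs w (f w)) _.
split; [exact: chart_cod_self|by rewrite chart_inv_self|].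
by rewrite chart_inv_self; exact: mem_chart_dom.
Qed.

End Differentials.

Section FieldsInCharts.
Context {R : realType} {n : nat} {M : smoothManifoldType R n}.
Implicit Types (u w : M) (X Y : M -> 'rV[R]_n).

Lemma vf_in_chart_center X u : vf_in_chart X u (chart u u) = X u.
Proof.
rewrite /vf_in_chart chart_inv_self.
exact: (@diff_transition_id _ _ _ u _ _ (chart_cod_self u)).
Qed.

Lemma vf_in_chartK X u p : chart_cod u p ->
  'd (transition u (chart_inv u p)) p (vf_in_chart X u p) = X (chart_inv u p).
Proof.
move=> up; set w := chart_inv u p.
have wu : overlap w u (chart w w).
  by apply: overlap_center; exact: chart_inv_dom.
have E : transition w u (chart w w) = p.
  by rewrite /transition chart_inv_self /w chart_invK.
by have := diff_transitionK (X w) wu; rewrite E.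
Qed.

Lemma metric_in_chartE (g : M -> 'rV[R]_n -> 'rV[R]_n -> R) X Y u p : chart_cod u p ->
  metric_in_chart g u (vf_in_chart X u p) (vf_in_chart Y u p) p =
  g (chart_inv u p) (X (chart_inv u p)) (Y (chart_inv u p)).
Proof.
move=> up; rewrite /metric_in_chart.
by rewrite (vf_in_chartK X up) (vf_in_chartK Y up).
Qed.

End FieldsInCharts.

(** * Invariant vector fields *)

Section PartialMaps.
Context {R : realType} {U V W : normedModType R}.

(** A slice [p |-> (p, q)] is the affine map [inj_left p + (0, q)], to which the affine substitution
    lemmas apply. *)
Definition inj_left (x : U) : U * V := (x, 0).
Definition inj_right (y : V) : U * V := (0, y).

Fact inj_left_linear : linear inj_left.
Proof.
move=> a x y; rewrite /inj_left; apply/pair_equal_spec; split=> //=.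
by rewrite scaler0 addr0.
Qed.

Fact inj_right_linear : linear inj_right.
Proof.
move=> a x y; rewrite /inj_right; apply/pair_equal_spec; split=> //=.
by rewrite scaler0 addr0.
Qed.

HB.instance Definition _ := GRing.isLinear.Build R U (U * V)%type _ inj_left inj_left_linear.
HB.instance Definition _ := GRing.isLinear.Build R V (U * V)%type _ inj_right inj_right_linear.

Lemma inj_left_continuous : continuous inj_left.
Proof. by move=> x; apply: cvg_pair => //; exact: cvg_cst. Qed.

Lemma inj_right_continuous : continuous inj_right.
Proof. by move=> x; apply: cvg_pair => //; exact: cvg_cst. Qed.

Lemma inj_leftE p q : inj_left p + (0, q) = (p, q).
Proof. by apply/pair_equal_spec; split; rewrite /= ?addr0 ?add0r. Qed.

Lemma inj_rightE p q : inj_right q + (p, 0) = (p, q).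
Proof. by apply/pair_equal_spec; split; rewrite /= ?addr0 ?add0r. Qed.

Implicit Types (F : U * V -> W).

Lemma partial_left F (p : U) (q : V) : differentiable F (p, q) ->
  differentiable (fun p' => F (p', q)) p /\
  forall x, 'd (fun p' => F (p', q)) p x = 'D_(x, 0) F (p, q).
Proof.
move=> dF.
have [dA DA] := diff_affine (0, q) p inj_left_continuous.
have dF' : differentiable F (inj_left p + (0, q)) by rewrite inj_leftE.
have E : \forall y \near p, F (y, q) = F (inj_left y + (0, q)).
  by near=> y; rewrite inj_leftE.
have [d D] := diff_comp_near dA dF' E.
split=> [|x]; first exact: d.
apply: (etrans (D x)); rewrite (congr1 (fun f => f x) DA) inj_leftE deriveE //.
Unshelve. all: by end_near. Qed.

Lemma partial_right F (p : U) (q : V) : differentiable F (p, q) ->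
  differentiable (fun q' => F (p, q')) q /\
  forall y, 'd (fun q' => F (p, q')) q y = 'D_(0, y) F (p, q).
Proof.
move=> dF.
have [dA DA] := diff_affine (p, 0) q inj_right_continuous.
have dF' : differentiable F (inj_right q + (p, 0)) by rewrite inj_rightE.
have E : \forall y \near q, F (p, y) = F (inj_right y + (p, 0)).
  by near=> y; rewrite inj_rightE.
have [d D] := diff_comp_near dA dF' E.
split=> [|x]; first exact: d.
apply: (etrans (D x)); rewrite (congr1 (fun f => f x) DA) inj_rightE deriveE //.
Unshelve. all: by end_near. Qed.

Lemma smooth_partial_left F (A : set (U * V)) (q : V) : open A -> smooth_on A F ->
  smooth_on [set p | A (p, q)] (fun p => F (p, q)).
Proof.
move=> oA sF.
have eA : [set p | A (p, q)] = [set p | A (inj_left p + (0, q))].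
  by apply/funext => p; rewrite /mkset inj_leftE.
have eF : (fun p => F (p, q)) = (fun p => F (inj_left p + (0, q))).
  by apply/funext => p; rewrite inj_leftE.
by rewrite eA eF; exact: smooth_on_affine (0, q) inj_left_continuous oA sF.
Qed.

Lemma smooth_partial_right F (A : set (U * V)) (p : U) : open A -> smooth_on A F ->
  smooth_on [set q | A (p, q)] (fun q => F (p, q)).
Proof.
move=> oA sF.
have eA : [set q | A (p, q)] = [set q | A (inj_right q + (p, 0))].
  by apply/funext => q; rewrite /mkset inj_rightE.
have eF : (fun q => F (p, q)) = (fun q => F (inj_right q + (p, 0))).
  by apply/funext => q; rewrite inj_rightE.
by rewrite eA eF; exact: smooth_on_affine (p, 0) inj_right_continuous oA sF.
Qed.

End PartialMaps.

Section Multiplication.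
Context {R : realType} {n : nat} {G : lieGroupType R n}.
Implicit Types (u v w t : G) (p q x y : 'rV[R]_n).

(* Multiplication read in the charts at u, v (factors) and w (product). *)
Definition cmul u v w (z : 'rV[R]_n * 'rV[R]_n) : 'rV[R]_n :=
  chart w (chart_inv u z.1 * chart_inv v z.2)%g.

Definition cmul_dom u v w : set ('rV[R]_n * 'rV[R]_n) :=
  [set z | [/\ chart_cod u z.1, chart_cod v z.2 &
               chart_dom w (chart_inv u z.1 * chart_inv v z.2)%g]].

Lemma cmul_smooth u v w : smooth_on (cmul_dom u v w) (cmul u v w).
Proof. exact: mulg_smooth. Qed.

Lemma cmul_dom_open u v w : open (cmul_dom u v w).
Proof.
rewrite openE => -[p q] [/= up vq wpq]; rewrite /interior.
have [[A B] [/= nA nB] AB] := mulg_continuous (chart_inv u p, chart_inv v q) _ (near_dom wpq).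
have hA := near_chart_inv up nA; have hB := near_chart_inv vq nB.
exists ([set p' | chart_cod u p' /\ A (chart_inv u p')],
        [set q' | chart_cod v q' /\ B (chart_inv v q')]) => //=.
move=> [p' q'] [/= [up' Ap'] [vq' Bq']]; split=> //=.
exact: (AB (chart_inv u p', chart_inv v q')).
Qed.

Lemma mulg_left_mdifferentiable u w : mdifferentiable (fun v => (u * v)%g) w.
Proof.
split.
  apply: (@continuous_comp _ _ _ (fun v => (u, v)) (fun z : G * G => (z.1 * z.2)%g)).
    by apply: cvg_pair => //; exact: cvg_cst.
  exact: mulg_continuous.
have D : cmul_dom u w (u * w)%g (chart u u, chart w w).
  by split; rewrite /= ?chart_inv_self; [exact: chart_cod_self|
    exact: chart_cod_self|exact: mem_chart_dom].
have [] := partial_right (smooth_on_differentiable (cmul_smooth u w (u * w)%g) D).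
by rewrite /cmul /= chart_inv_self.
Qed.

Lemma mulg_right_mdifferentiable u w : mdifferentiable (fun v => (v * u)%g) w.
Proof.
split.
  apply: (@continuous_comp _ _ _ (fun v => (v, u)) (fun z : G * G => (z.1 * z.2)%g)).
    by apply: cvg_pair => //; exact: cvg_cst.
  exact: mulg_continuous.
have D : cmul_dom w u (w * u)%g (chart w w, chart u u).
  by split; rewrite /= ?chart_inv_self; [exact: chart_cod_self|
    exact: chart_cod_self|exact: mem_chart_dom].
have [] := partial_left (smooth_on_differentiable (cmul_smooth w u (w * u)%g) D).
by rewrite /cmul /= chart_inv_self.
Qed.

Local Notation o := (1%g : G).
Local Notation po := (chart (1%g : G) (1%g : G)).

Lemma cmul_dom_left u p : chart_cod u p -> cmul_dom u o u (p, po).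
Proof.
move=> up; split=> //=; first exact: chart_cod_self.
by rewrite chart_inv_self mulg1; exact: chart_inv_dom.
Qed.

Lemma cmul_dom_right u p : chart_cod u p -> cmul_dom o u u (po, p).
Proof.
move=> up; split=> //=; first exact: chart_cod_self.
by rewrite chart_inv_self mul1g; exact: chart_inv_dom.
Qed.

(** In a fixed chart the field is a partial derivative of the multiplication, in its second factor
    at the identity; its smoothness in [p] is then inherited from the joint smoothness of the
    product. *)
Lemma left_vf_chart x u p : chart_cod u p ->
  vf_in_chart (left_invariant_vf x) u p = 'D_(0, x) (cmul u o u) (p, po).
Proof.
move=> up; have D := cmul_dom_left up.
have [_ Dr] := partial_right (smooth_on_differentiable (cmul_smooth u o u) D).
apply: etrans (Dr x); rewrite /vf_in_chart.
set w := chart_inv u p.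
have uw : chart_dom u (w * o)%g by rewrite mulg1; exact: chart_inv_dom.
have [_ E] := mdiff_charts (mulg_left_mdifferentiable w o)
  (chart_cod_self o) (chart_inv_self o) uw.
have E' := etrans (E x) (congr1 (fun y => 'd (transition (w * o)%g u) (chart (w * o)%g (w * o)%g)
  (mdiff (fun v => (w * v)%g) o y)) (diff_transition_id x (chart_cod_self o))).
rewrite mulg1 in E'.
exact: esym E'.
Qed.

Lemma right_vf_chart x u p : chart_cod u p ->
  vf_in_chart (right_invariant_vf x) u p = 'D_(x, 0) (cmul o u u) (po, p).
Proof.
move=> up; have D := cmul_dom_right up.
have [_ Dr] := partial_left (smooth_on_differentiable (cmul_smooth o u u) D).
apply: etrans (Dr x); rewrite /vf_in_chart.
set w := chart_inv u p.
have uw : chart_dom u (o * w)%g by rewrite mul1g; exact: chart_inv_dom.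
have [_ E] := mdiff_charts (mulg_right_mdifferentiable w o)
  (chart_cod_self o) (chart_inv_self o) uw.
have E' := etrans (E x) (congr1 (fun y => 'd (transition (o * w)%g u) (chart (o * w)%g (o * w)%g)
  (mdiff (fun v => (v * w)%g) o y)) (diff_transition_id x (chart_cod_self o))).
rewrite mul1g in E'.
exact: esym E'.
Qed.

Lemma left_vf_smooth x : smooth_vf (left_invariant_vf x : G -> 'rV[R]_n).
Proof.
move=> u; apply: (@smooth_on_eq _ _ _ _ (fun p => 'D_(0, x) (cmul u o u) (p, po))).
- exact: open_cod.
- by move=> p up; rewrite left_vf_chart.
have H := smooth_partial_left po (@cmul_dom_open u o u)
  (smooth_on_derive (0, x) (cmul_smooth u o u)).
by apply: smooth_on_sub H => p; exact: cmul_dom_left.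
Qed.

Lemma right_vf_smooth x : smooth_vf (right_invariant_vf x : G -> 'rV[R]_n).
Proof.
move=> u; apply: (@smooth_on_eq _ _ _ _ (fun p => 'D_(x, 0) (cmul o u u) (po, p))).
- exact: open_cod.
- by move=> p up; rewrite right_vf_chart.
have H := smooth_partial_right po (@cmul_dom_open o u u)
  (smooth_on_derive (x, 0) (cmul_smooth o u u)).
by apply: smooth_on_sub H => p; exact: cmul_dom_right.
Qed.

Lemma mdiff_left1 x v : mdiff (fun w => (o * w)%g) v x = x.
Proof. by apply: mdiff_near_id; apply: filterS filterT => w _; rewrite mul1g. Qed.

Lemma left_vf1 x : left_invariant_vf x o = x.
Proof. exact: mdiff_left1. Qed.

Lemma right_vf1 x : right_invariant_vf x o = x.
Proof. by apply: mdiff_near_id; apply: filterS filterT => w _; rewrite mulg1. Qed.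

Lemma left_vfM x u v :
  left_invariant_vf x (u * v)%g = mdiff (fun w => (u * w)%g) v (left_invariant_vf x v).
Proof.
have E := mdiff_comp x (mulg_left_mdifferentiable v o)
  (mulg_left_mdifferentiable u (v * o)%g).
have F : (fun w => (u * v * w)%g) = (fun w => (u * w)%g) \o (fun w => (v * w)%g).
  by apply/funext => w /=; rewrite mulgA.
by rewrite /left_invariant_vf F; rewrite mulg1 in E; exact: E.
Qed.

Lemma left_vf_linear a x y u :
  left_invariant_vf (a *: x + y) u = a *: left_invariant_vf x u + left_invariant_vf y u :> 'rV[R]_n.
Proof. by rewrite /left_invariant_vf /mdiff linearP. Qed.

Lemma mdiff_leftK u v x :
  mdiff (fun w => (u^-1 * w)%g) (u * v)%g (mdiff (fun w => (u * w)%g) v x) = x.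
Proof.
have E := mdiff_comp x (mulg_left_mdifferentiable u v)
  (mulg_left_mdifferentiable (u^-1)%g (u * v)%g).
apply: etrans (esym E) _.
by apply: mdiff_near_id; apply: filterS filterT => w _ /=; rewrite mulKg.
Qed.

Lemma mdiff_leftVK u v x :
  mdiff (fun w => (u * w)%g) v (mdiff (fun w => (u^-1 * w)%g) (u * v)%g x) = x.
Proof.
have := mdiff_leftK (u^-1)%g (u * v)%g x.
by rewrite invgK mulKg.
Qed.

Lemma left_vf_surj u (y : 'rV[R]_n) : exists x, left_invariant_vf x u = y.
Proof.
exists (mdiff (fun w => (u^-1 * w)%g) (u * o)%g y).
exact: mdiff_leftVK.
Qed.

(** Both sides are the mixed second derivative of the multiplication at the pair of identities, in
    the two possible orders. *)
Lemma left_right_commute b x :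
  'D_b (vf_in_chart (right_invariant_vf x) o) po =
  'D_x (vf_in_chart (left_invariant_vf b) o) po :> 'rV[R]_n.
Proof.
have D : cmul_dom o o o (po, po) by exact/cmul_dom_left/chart_cod_self.
have sm := cmul_smooth o o o.
have no : \forall p \near po, chart_cod o p by exact/near_cod/chart_cod_self.
rewrite (near_eq_derive (g := fun p => 'D_(x, 0) (cmul o o o) (po, p))); last first.
  by apply: filterS no => p; exact: right_vf_chart.
rewrite (near_eq_derive (f := vf_in_chart (left_invariant_vf b) o)
  (g := fun p => 'D_(0, b) (cmul o o o) (p, po))); last first.
  by apply: filterS no => p; exact: left_vf_chart.
have [d1 D1] := partial_right
  (smooth_on_differentiable (smooth_on_derive (x, 0) sm) D).
have [d2 D2] := partial_left
  (smooth_on_differentiable (smooth_on_derive (0, b) sm) D).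
apply: (etrans (deriveE _ d1)); apply: (etrans (D1 b)).
apply: etrans (esym (deriveE _ d2)); apply: etrans (esym (D2 x)).
exact: mixed_derivative (@cmul_dom_open o o o) D sm.
Qed.

End Multiplication.

(** * Naturality of the bracket of vector fields *)

Section BracketNaturality.
Context {R : realType} {n m : nat}.

Lemma diff_sum_basis (f : 'rV[R]_n -> 'rV[R]_m) (p y : 'rV[R]_n) (j : 'I_m) :
    differentiable f p ->
  ('d f p y) 0 j = \sum_l y 0 l * ('D_(delta_mx 0 l) f p) 0 j.
Proof.
move=> df; rewrite {1}[y]row_sum_delta linear_sum summxE; apply: eq_bigr => l _.
by rewrite linearZ deriveE // [LHS]mxE.
Qed.

(** Product rule for [q |-> 'd phi q (Y q)]: one term differentiates [Y], the other freezes [Y] at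
    [p] and differentiates [phi] a second time. Expansion in the standard basis reduces it to
    products of real functions. *)
Lemma derive_diff_apply (phi : 'rV[R]_n -> 'rV[R]_m) (Y : 'rV[R]_n -> 'rV[R]_n)
    (A : set 'rV[R]_n) (p v : 'rV[R]_n) (F : 'rV[R]_n -> 'rV[R]_m) :
    open A -> A p -> smooth_on A phi -> differentiable Y p ->
    differentiable F p -> (\forall q \near p, F q = 'd phi q (Y q)) ->
  'D_v F p = 'd phi p ('D_v Y p) + 'D_v (fun q => 'D_(Y p) phi q) p.
Proof.
move=> oA Ap sphi dY dF FE.
pose e (l : 'I_n) : 'rV[R]_n := delta_mx 0 l.
pose D l q := 'D_(e l) phi q.
have nA : \forall q \near p, A q by exact: open_nbhs_nbhs.
have dphi q : A q -> differentiable phi q by exact: smooth_on_differentiable sphi.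
have sD l : smooth_on A (D l) by exact: smooth_on_derive.
have dD l : differentiable (D l) p by exact: smooth_on_differentiable (sD l) Ap.
have dsD : differentiable (fun q => 'D_(Y p) phi q) p.
  exact: smooth_on_differentiable (smooth_on_derive _ sphi) Ap.
apply/rowP => j.
have entry (g : 'rV[R]_n -> 'rV[R]_m) : differentiable g p ->
    ('D_v g p) 0 j = 'D_v (fun q => g q 0 j) p.
  by move=> dg; rewrite derive_mx ?mxE //; exact: diff_derivable.
have dDj l : derivable (fun q => D l q 0 j) p v.
  by have /derivable_mxP := diff_derivable (v := v) (dD l); exact.
have dYl l : derivable (fun q => Y q 0 l) p v.
  by have /derivable_mxP := diff_derivable (v := v) dY; exact.
have sumE (c : 'I_n -> 'rV[R]_n -> R) (H : 'rV[R]_n -> R) :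
    (forall l, derivable (c l) p v) ->
    (\forall q \near p, H q = \sum_l c l q * D l q 0 j) ->
    'D_v H p = \sum_l (c l p * 'D_v (fun q => D l q 0 j) p + D l p 0 j * 'D_v (c l) p).
  move=> dc HE; rewrite (near_eq_derive _ HE).
  have -> : (fun q => \sum_l c l q * D l q 0 j) =
      \sum_l (fun q => c l q * D l q 0 j).
    by apply/funext => q; rewrite fct_sumE.
  rewrite derive_sum; last by move=> l; exact: derivableM.
  by apply: eq_bigr => l _; rewrite (deriveM (dc l) (dDj l)).
rewrite [RHS]mxE (entry _ dF) (entry _ dsD).
rewrite (sumE (fun l q => Y q 0 l)) //; last first.
  apply: filterS2 nA FE => q Aq ->; exact: diff_sum_basis (dphi q Aq).
rewrite (sumE (fun l q => Y p 0 l) (fun q => ('D_(Y p) phi q) 0 j)); last first.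
- apply: filterS nA => q Aq; rewrite deriveE; last exact: dphi.
  exact: diff_sum_basis (dphi q Aq).
- by move=> l; exact: derivable_cst.
rewrite (diff_sum_basis _ _ (dphi p Ap)) -big_split; apply: eq_bigr => l _ /=.
rewrite derive_cst mulr0 addr0 addrC; congr (_ + _).
rewrite mulrC; congr (_ * _).
by rewrite derive_mx ?mxE //; exact: diff_derivable.
Qed.

(** The second derivatives of [phi] enter both halves of the bracket and cancel by symmetry. *)
Lemma bracket_natural (phi : 'rV[R]_n -> 'rV[R]_m) (A : set 'rV[R]_n) (p : 'rV[R]_n)
    (X Y : 'rV[R]_n -> 'rV[R]_n) (X' Y' : 'rV[R]_m -> 'rV[R]_m) :
    open A -> A p -> smooth_on A phi ->
    differentiable X p -> differentiable Y p ->
    differentiable X' (phi p) -> differentiable Y' (phi p) ->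
    (\forall q \near p, X' (phi q) = 'd phi q (X q)) ->
    (\forall q \near p, Y' (phi q) = 'd phi q (Y q)) ->
  'D_(X' (phi p)) Y' (phi p) - 'D_(Y' (phi p)) X' (phi p) =
  'd phi p ('D_(X p) Y p - 'D_(Y p) X p).
Proof.
move=> oA Ap sphi dX dY dX' dY' XE YE.
have dphi : differentiable phi p by exact: smooth_on_differentiable sphi Ap.
have half (Z W : 'rV[R]_n -> 'rV[R]_n) (Z' W' : 'rV[R]_m -> 'rV[R]_m) :
    differentiable W p -> differentiable W' (phi p) ->
    Z' (phi p) = 'd phi p (Z p) ->
    (\forall q \near p, W' (phi q) = 'd phi q (W q)) ->
    'D_(Z' (phi p)) W' (phi p) =
    'd phi p ('D_(Z p) W p) + 'D_(Z p) (fun q => 'D_(W p) phi q) p.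
  move=> dW dW' ZE WE.
  have dF : differentiable (W' \o phi) p by exact: differentiable_comp.
  rewrite -(derive_diff_apply (Z p) oA Ap sphi dW dF WE).
  rewrite (deriveE _ dF) (deriveE _ dW') ZE.
  exact: esym (congr1 (fun f => f (Z p)) (diff_comp dphi dW')).
rewrite (half X Y X' Y') //; last exact: nbhs_singleton XE.
rewrite (half Y X Y' X') //; last exact: nbhs_singleton YE.
have M := mixed_derivative (X p) (Y p) oA Ap sphi.
have alg (a b c : 'rV[R]_m) : a + c - (b + c) = a - b by rewrite opprD addrACA subrr addr0.
apply: etrans (esym (linearB _ _ _)).
rewrite M; exact: alg.
Qed.

End BracketNaturality.

Section LieBracket.
Context {R : realType} {n : nat} {G : lieGroupType R n}.
Implicit Types (u v w : G) (p q x y z : 'rV[R]_n).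
Local Notation o := (1%g : G).
Local Notation po := (chart (1%g : G) (1%g : G)).
Local Notation L := (fun x => left_invariant_vf x : G -> 'rV[R]_n).

Lemma left_vf_chart_differentiable x u p : chart_cod u p ->
  differentiable (vf_in_chart (L x) u) p.
Proof. exact: smooth_on_differentiable (left_vf_smooth x u). Qed.

Lemma lie_bracketE x y :
  lie_bracket G x y = 'D_x (vf_in_chart (L y) o) po - 'D_y (vf_in_chart (L x) o) po.
Proof. by rewrite /lie_bracket /vf_bracket !left_vf1. Qed.

Lemma lie_bracketC x y : lie_bracket G x y = - lie_bracket G y x.
Proof. by rewrite !lie_bracketE opprB. Qed.

Lemma vf_in_chart_linear a x y u p : vf_in_chart (L (a *: x + y)) u p =
  a *: vf_in_chart (L x) u p + vf_in_chart (L y) u p.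
Proof. by rewrite /vf_in_chart left_vf_linear linearP. Qed.

Lemma lie_bracket_linear a x y z :
  lie_bracket G (a *: x + y) z = a *: lie_bracket G x z + lie_bracket G y z.
Proof.
have d x := left_vf_chart_differentiable x (chart_cod_self o).
rewrite !lie_bracketE.
have -> : vf_in_chart (L (a *: x + y)) o =
    (a \*: vf_in_chart (L x) o) + vf_in_chart (L y) o.
  by apply/funext => p; rewrite vf_in_chart_linear.
rewrite deriveD; [|exact/derivableZ/diff_derivable|exact: diff_derivable].
rewrite deriveZ; last exact: diff_derivable.
have E : 'D_(a *: x + y) (vf_in_chart (L z) o) po =
    a *: 'D_x (vf_in_chart (L z) o) po + 'D_y (vf_in_chart (L z) o) po.
  have D t : 'D_t (vf_in_chart (L z) o) po = 'd (vf_in_chart (L z) o) po t.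
    exact: deriveE (d z).
  exact: etrans (D _) (etrans (linearP _ a x y)
    (esym (congr2 (fun s t => a *: s + t) (D x) (D y)))).
have alg (s t s' t' : 'rV[R]_n) :
    a *: s + t - (a *: s' + t') = a *: (s - s') + (t - t').
  by rewrite scalerBr opprD addrACA.
rewrite E; exact: alg.
Qed.

(** Left translation by [u], read in charts as [phi], relates each left-invariant field near the
    identity to the same field near [u]. Naturality then transports the bracket from the identity,
    where it defines [lie_bracket]. *)
Lemma left_vf_bracket x y : vf_bracket (L x) (L y) = L (lie_bracket G x y).
Proof.
apply/funext => u.
pose phi q := cmul u o u (chart u u, q).
pose A := [set q | cmul_dom u o u (chart u u, q)].
have cu : chart_cod u (chart u u) by exact: chart_cod_self.
have Apo : A po by exact: cmul_dom_left.
have oA : open A.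
  have -> : A = [set q | cmul_dom u o u (inj_right q + (chart u u, 0))].
    by apply/funext => q; rewrite /A /mkset inj_rightE.
  have c : continuous (fun q => inj_right q + (chart u u, 0)).
    move=> q; apply: differentiable_continuous.
    by have [] := @diff_affine R _ _ inj_right (chart u u, 0) q inj_right_continuous.
  by have /continuousP := c; apply; exact: cmul_dom_open.
have sphi : smooth_on A phi by exact: smooth_partial_right (@cmul_dom_open _ _ _ u o u)
  (cmul_smooth u o u).
have phipo : phi po = chart u u.
  by rewrite /phi /cmul /= !chart_inv_self mulg1.
have invphi q : A q -> chart_inv u (phi q) = (u * chart_inv o q)%g.
  move=> [_ _ /=]; rewrite chart_inv_self => uq.
  by rewrite /phi /cmul /= chart_inv_self chartK.
have phiE q : phi q = (chart u \o (fun v => (u * v)%g) \o chart_inv o) q.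
  by rewrite /phi /cmul /= chart_inv_self.
have field z : \forall q \near po,
    vf_in_chart (L z) u (phi q) = 'd phi q (vf_in_chart (L z) o q).
  have nA : \forall q \near po, A q by exact: open_nbhs_nbhs.
  apply: filterS nA => q Aq; have [_ /= oq uq] := Aq.
  rewrite chart_inv_self in uq.
  have [_ E] := mdiff_charts (mulg_left_mdifferentiable u (chart_inv o q)) oq erefl uq.
  have -> : phi = chart u \o (fun v => (u * v)%g) \o chart_inv o by apply/funext.
  apply: etrans (esym (E _)).
  have K := vf_in_chartK (L z) oq.
  apply: etrans (esym (congr1 (fun x => 'd (transition (u * chart_inv o q)%g u)
     (chart (u * chart_inv o q)%g (u * chart_inv o q)%g)
     (mdiff (fun v => (u * v)%g) (chart_inv o q) x)) K)).
  rewrite -left_vfM -phiE.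
  have E2 v : v = chart_inv u (phi q) ->
    vf_in_chart (L z) u (phi q) = 'd (transition v u) (chart v v) (L z v) by move=> ->.
  exact: E2 (esym (invphi q Aq)).
have B := bracket_natural oA Apo sphi
  (left_vf_chart_differentiable x (chart_cod_self o))
  (left_vf_chart_differentiable y (chart_cod_self o)) _ _ (field x) (field y).
rewrite phipo in B.
have {}B := B (left_vf_chart_differentiable x cu) (left_vf_chart_differentiable y cu).
rewrite !vf_in_chart_center !left_vf1 in B.
apply: etrans B _; rewrite -lie_bracketE /left_invariant_vf /mdiff mulg1.
by have -> : phi = chart u \o (fun v => (u * v)%g) \o chart_inv o by apply/funext.
Qed.

End LieBracket.

(** * Almost abelian Lie algebras of constant curvature *)

Section AlmostAbelianAlgebra.
Context {R : realType} {n : nat}.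
Implicit Types (x y z w : 'rV[R]_n).
Variables (ip : 'rV[R]_n -> 'rV[R]_n -> R).
Variables (br nab : 'rV[R]_n -> 'rV[R]_n -> 'rV[R]_n) (c : R).
Local Notation "[[ x , y ]]" := (br x y) (at level 0).
Hypotheses
  (ip_linear : forall a x y z, ip (a *: x + y) z = a * ip x z + ip y z)
  (ip_sym : forall x y, ip x y = ip y x)
  (ip_pos : forall x, x != 0 -> 0 < ip x x)
  (br_linear : forall a x y z, [[a *: x + y, z]] = a *: [[x, z]] + [[y, z]])
  (brC : forall x y, [[x, y]] = - [[y, x]])
  (nabE : forall x y z,
     2 * ip (nab x y) z = ip [[x, y]] z - ip [[y, z]] x + ip [[z, x]] y)
  (sectional : forall x y, x != 0 -> y != 0 -> ip x y = 0 ->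
     ip (nab x (nab y y) - nab y (nab x y) - nab [[x, y]] y) x =
     c * (ip x x * ip y y)).

Lemma ipDl x y z : ip (x + y) z = ip x z + ip y z.
Proof. by have := ip_linear 1 x y z; rewrite scale1r mul1r. Qed.

Lemma ip0l z : ip 0 z = 0.
Proof. by have := ipDl 0 0 z; rewrite addr0 => /(congr1 (+%R^~ (- ip 0 z))); rewrite subrr addrK. Qed.

Lemma ipZl a x z : ip (a *: x) z = a * ip x z.
Proof. by have := ip_linear a x 0 z; rewrite addr0 ip0l addr0. Qed.

Lemma ipNl x z : ip (- x) z = - ip x z.
Proof. by rewrite -scaleN1r ipZl mulN1r. Qed.

Lemma ipBl x y z : ip (x - y) z = ip x z - ip y z.
Proof. by rewrite ipDl ipNl. Qed.

Lemma ipDr x y z : ip z (x + y) = ip z x + ip z y.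
Proof. by rewrite !(ip_sym z) ipDl. Qed.

Lemma ipNr x z : ip z (- x) = - ip z x.
Proof. by rewrite !(ip_sym z) ipNl. Qed.

Lemma ipZr a x z : ip z (a *: x) = a * ip z x.
Proof. by rewrite !(ip_sym z) ipZl. Qed.

Lemma ip0r z : ip z 0 = 0.
Proof. by rewrite (ip_sym z) ip0l. Qed.

Lemma ip_ge0 x : 0 <= ip x x.
Proof. by have [->|/ip_pos/ltW//] := eqVneq x 0; rewrite ip0l. Qed.

Lemma ip_eq0 x : ip x x = 0 -> x = 0.
Proof. by move=> h; apply/eqP/negP => /negP /ip_pos; rewrite h ltxx. Qed.

Lemma br0l y : [[0, y]] = 0.
Proof.
by have := br_linear (-1) 0 0 y; rewrite scaleN1r oppr0 addr0 scaleN1r addNr.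
Qed.

Lemma brNl x y : [[- x, y]] = - [[x, y]].
Proof.
by have := br_linear (-1) x 0 y; rewrite !scaleN1r addr0 br0l addr0.
Qed.

Lemma brNr x y : [[x, - y]] = - [[x, y]].
Proof. by rewrite (brC x (- y)) (brC x y) brNl. Qed.

Lemma brxx x : [[x, x]] = 0.
Proof.
apply/rowP => i; have := congr1 (fun v : 'rV[R]_n => v 0 i) (brC x x).
by rewrite !mxE; lra.
Qed.

Lemma brDl x y z : [[x + y, z]] = [[x, z]] + [[y, z]].
Proof. by have := br_linear 1 x y z; rewrite !scale1r. Qed.

Lemma brZl a x z : [[a *: x, z]] = a *: [[x, z]].
Proof. by have := br_linear a x 0 z; rewrite br0l !addr0. Qed.

Lemma brDr x y z : [[z, x + y]] = [[z, x]] + [[z, y]].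
Proof. by rewrite (brC z (x + y)) (brC z x) (brC z y) brDl opprD. Qed.

Lemma brZr a x z : [[z, a *: x]] = a *: [[z, x]].
Proof. by rewrite (brC z (a *: x)) (brC z x) brZl scalerN. Qed.

Lemma nab_eq0 x y :
  (forall z, ip [[x, y]] z - ip [[y, z]] x + ip [[z, x]] y = 0) -> nab x y = 0.
Proof.
move=> h; apply: ip_eq0.
by have := nabE x y (nab x y); rewrite h; lra.
Qed.

(** Pairing with the [n - 1] basis vectors of [h] is an [n] by [n - 1] matrix, so it has a nonzero
    left kernel. The converse inclusion holds because [h] and the line of [b] span everything. *)
Lemma exists_normal (h : {vspace 'rV[R]_n}) : (\dim h).+1 = n ->
  exists2 b, b != 0 & forall x, (x \in h) = (ip x b == 0).
Proof.
move=> dimh.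
pose A : 'M[R]_(n, \dim h) := \matrix_(i, j) ip (delta_mx 0 i) (vbasis h)`_j.
have : kermx A != 0.
  rewrite -mxrank_eq0 mxrank_ker subn_eq0 -ltnNge.
  by apply: leq_ltn_trans (rank_leq_col A) _; exact: eq_leq dimh.
move=> /rowV0Pn [b /sub_kermxP bA b0]; exists b => //.
have bE y : ip b y = \sum_i b 0 i * ip (delta_mx 0 i) y.
  rewrite {1}[b]row_sum_delta; elim/big_rec2: _ => [|i s t _ <-]; first exact: ip0l.
  by rewrite ipDl ipZl.
have hb x : x \in h -> ip x b = 0.
  move=> xh; rewrite (coord_vbasis xh).
  elim/big_rec: _ => [|i t _ tb]; first exact: ip0l.
  rewrite ipDl ipZl tb addr0 ip_sym bE.
  have := congr1 (fun v : 'rV[R]_(\dim h) => v 0 i) bA; rewrite !mxE => E.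
  rewrite (_ : \sum_i0 _ = 0) ?mulr0 // -[RHS]E.
  by apply: eq_bigr => k _; rewrite mxE.
have bb : ip b b != 0 by rewrite gt_eqF // ip_pos.
move=> x; apply/idP/eqP => [/hb//|xb].
have cap0 : (h :&: <[b]> = 0)%VS.
  apply/eqP; rewrite -subv0; apply/subvP => y; rewrite memv_cap memv0.
  move=> /andP[yh] /vlineP[k yk]; have := hb y yh.
  by rewrite yk ipZl => /eqP; rewrite mulf_eq0 (negbTE bb) orbF => /eqP ->; rewrite scale0r.
have full : (h + <[b]> = fullv)%VS.
  apply/eqP; rewrite eqEdim subvf dimv_disjoint_sum // dim_vline b0 addn1.
  rewrite dimvf dim_matrix; apply: eq_leq; apply: etrans (esym dimh).
  exact: mul1n.
have : x \in (h + <[b]>)%VS by rewrite full memvf.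
move=> /memv_addP [y yh] [z /vlineP [k ->] xE].
move: xb; rewrite xE ipDl ipZl (hb _ yh) add0r => /eqP.
by rewrite mulf_eq0 (negbTE bb) orbF => /eqP ->; rewrite scale0r addr0.
Qed.

Section AlmostAbelian.
Variables (h : {vspace 'rV[R]_n}) (b : 'rV[R]_n).
Hypotheses (h_ideal : forall x y, y \in h -> [[x, y]] \in h)
  (h_abelian : forall x y, x \in h -> y \in h -> [[x, y]] = 0)
  (b_neq0 : b != 0) (h_normal : forall x, (x \in h) = (ip x b == 0)).
Hypotheses (c_neq0 : c != 0) (h_neq0 : (0 < \dim h)%N).

Let beta_gt0 : 0 < ip b b. Proof. exact: ip_pos b_neq0. Qed.

Let hb x : x \in h -> ip x b = 0. Proof. by rewrite h_normal => /eqP. Qed.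

Let decomp z : exists2 w, w \in h & z = (ip z b / ip b b) *: b + w.
Proof.
exists (z - (ip z b / ip b b) *: b); last by rewrite addrC subrK.
by rewrite h_normal ipBl ipZl divfK ?subrr // gt_eqF.
Qed.

Let brb z w k : z = k *: b + w -> [[b, z]] = [[b, w]].
Proof. by move=> ->; rewrite brDr brZr brxx scaler0 add0r. Qed.

Let brh z w k x : z = k *: b + w -> w \in h -> x \in h -> [[z, x]] = k *: [[b, x]].
Proof. by move=> -> wh xh; rewrite brDl brZl (h_abelian wh xh) addr0. Qed.

Let brb_h z : [[b, z]] \in h.
Proof. by have [w wh /brb ->] := decomp z; exact: h_ideal. Qed.

(** The Koszul term pairing a bracket of the ideal with [b] drops out. What remains says that
    [- nab x b] is the symmetric part of [ad b] applied to [x]: the shape operator of the ideal, up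
    to the length of [b]. *)
Lemma normal_nabla x : x \in h -> forall z,
  2 * ip (- nab x b) z = ip [[b, x]] z + ip [[b, z]] x.
Proof.
move=> xh z; rewrite (ipNl (nab x b)) mulrN nabE.
have alg (s t : R) : - (- s - t + 0) = s + t by ring.
rewrite (hb (h_ideal z xh)).
rewrite (brC x b).
rewrite (ipNl [[b, x]] z).
exact: alg.
Qed.

(** [nab b b] vanishes because [ad b] has image orthogonal to [b], and brackets within the ideal
    vanish, so the curvature of the plane of [b] and [x] involves only [ad b] and its symmetric
    part. *)
Lemma normal_curvature x : x \in h -> x != 0 -> let s := - nab x b in
  c * (ip x x * ip b b) = ip s s - 2 * ip [[b, x]] s.
Proof.
move=> xh x0 s.
have sE := normal_nabla xh; rewrite -/s in sE.
have nE : nab x b = - s by rewrite opprK.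
clearbody s.
have sh : s \in h.
  have two : (2 : R) != 0 by [].
  rewrite h_normal; apply/eqP; apply: (mulfI two); rewrite sE brxx ip0l.
  by rewrite (hb (brb_h x)) addr0 mulr0.
rewrite -(sectional x0 b_neq0 (hb xh)).
have -> : nab b b = 0.
  apply: nab_eq0 => z; rewrite brxx ip0l (brC z b).
  by rewrite ipNl (hb (brb_h z)) subr0 oppr0 addr0.
have -> : nab x 0 = 0.
  apply: nab_eq0 => z; rewrite (brC x 0) !br0l oppr0.
  by rewrite !ip0l ip0r subr0 addr0.
rewrite nE !ipBl ip0l.
have E1 : 2 * ip (nab b (- s)) x = - ip [[b, s]] x + ip [[b, x]] s.
  rewrite nabE (brNr b s) (brNl s x) (h_abelian sh xh) oppr0.
  rewrite ip0l (brC x b) (ipNl [[b, s]]) (ipNl [[b, x]]).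
  by rewrite (ipNr s) opprK subr0.
have E2 : 2 * ip (nab [[x, b]] b) x = ip [[b, [[b, x]]]] x + ip [[b, x]] [[b, x]].
  rewrite nabE (brC x b) (brC (- [[b, x]]) b) (brNr b).
  rewrite opprK (brNr x) (h_abelian xh (brb_h x)) oppr0 ip0l addr0.
  by rewrite (ipNr [[b, x]]) opprK.
(* These two instances eliminate the pairings of [[b, s]] and [[b, [b, x]]] with [x]. *)
have := sE s; have := sE [[b, x]].
rewrite (ip_sym s [[b, x]]); lra.
Qed.

Lemma normal_not_skew : ~ (forall x, ip [[b, x]] x = 0).
Proof.
move=> sk.
have [x xh x0] : exists2 x, x \in h & x != 0.
  exists (vpick h); first exact: memv_pick.
  by rewrite vpick0 -dimv_eq0 -lt0n.
have pol z : ip [[b, x]] z + ip [[b, z]] x = 0.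
  have := sk (x + z); rewrite brDr ipDl !ipDr !sk; lra.
have s0 : - nab x b = 0.
  apply: ip_eq0; have := normal_nabla xh (- nab x b).
  by rewrite pol; lra.
have := normal_curvature xh x0; rewrite /= s0 !ip0r mulr0 subr0 => /eqP.
by rewrite !mulf_eq0 (negbTE c_neq0) !gt_eqF // ip_pos.
Qed.

(** If [y = b *m T] is nonzero, it lies in the ideal. Deriving [[y, z] = 0] for [z] in the ideal
    shows that [ad b] has rank at most one there, with image spanned by [v = [b, y]]; deriving [v]
    gives [v *m T = 0], whence [v] is orthogonal to [y] and [ad b] kills [v]. Such a Heisenberg-like
    algebra has planes of curvature of both signs. *)
Lemma derivation_normal (T : 'M[R]_n) :
    (forall x y, ip (x *m T) y = - ip x (y *m T)) ->
    (forall x y, [[x, y]] *m T = [[x *m T, y]] + [[x, y *m T]]) ->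
  b *m T = 0.
Proof.
move=> sk der; apply/eqP/negP => /negP; set y := b *m T => y0.
have Y0 : 0 < ip y y by exact: ip_pos y0.
have yh : y \in h.
  rewrite h_normal; apply/eqP.
  by have := sk b b; rewrite -/y (ip_sym b y); lra.
have Tb x : ip (x *m T) b = - ip x y by rewrite sk.
have rank1 z : z \in h -> ip z y *: [[b, y]] = ip y y *: [[b, z]].
  move=> zh; have := der y z; rewrite (h_abelian yh zh) mul0mx => /esym.
  have [w wh wE] := decomp (y *m T); have [w' wh' wE'] := decomp (z *m T).
  rewrite (brh wE wh zh) (brC y) (brh wE' wh' yh) !Tb.
  move=> /(congr1 ( *:%R (ip b b))); rewrite scalerDr scaler0 scalerN !scalerA.
  have bb : ip b b != 0 by rewrite gt_eqF.
  rewrite !(mulrC (ip b b)) !divfK // !scaleNr opprK => /eqP.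
  by rewrite addrC subr_eq0 => /eqP.
set v := [[b, y]] in rank1.
have vh : v \in h by exact: brb_h.
have yy : ip (y *m T) y = 0 by have := sk y y; rewrite (ip_sym y (y *m T)); lra.
have vT : v *m T = 0.
  rewrite /v der -/y brxx add0r.
  have [w wh wE] := decomp (y *m T); rewrite (brb wE).
  have wy : ip w y = 0.
    by move: yy; rewrite wE ipDl ipZl (ip_sym b y) (hb yh) mulr0 add0r.
  have := rank1 w wh; rewrite wy scale0r => /esym/eqP.
  by rewrite scaler_eq0 gt_eqF //= => /eqP.
have vy : ip v y = 0 by have := sk v b; rewrite vT ip0l -/y; lra.
have brv z : ip [[b, z]] y = 0.
  have [w wh /brb ->] := decomp z.
  have := congr1 (fun t => ip t y) (rank1 w wh); rewrite !ipZl vy mulr0 => /esym/eqP.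
  by rewrite mulf_eq0 gt_eqF //= => /eqP.
have bv : [[b, v]] = 0.
  have := rank1 v vh; rewrite vy scale0r => /esym/eqP.
  by rewrite scaler_eq0 gt_eqF //= => /eqP.
(* Otherwise [ad b] vanishes, hence is skew-symmetric. *)
have v0 : v != 0.
  apply/eqP => v0; apply: normal_not_skew => x.
  have [w wh /brb ->] := decomp x.
  have := rank1 w wh; rewrite v0 scaler0 => /esym/eqP.
  by rewrite scaler_eq0 gt_eqF //= => /eqP ->; rewrite ip0l.
have V0 : 0 < ip v v by exact: ip_pos v0.
(* As [[b, v] = 0], the plane of [b] and [v] has nonnegative curvature. *)
have := normal_curvature vh v0; rewrite /= bv ip0l mulr0 subr0 => cv.
have c_ge0 : 0 <= c.
  by rewrite -(pmulr_lge0 _ (mulr_gt0 V0 beta_gt0)) cv ip_ge0.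
(* Here the symmetric part [s] is [v / 2], so [|s|^2 - 2 <v, s>] equals [- 3/4 |v|^2]: the plane of
   [b] and [y] has negative curvature. *)
have := normal_curvature yh y0; have sE := normal_nabla yh.
move: sE; rewrite /= -/v; set s := - nab y b => sE cy.
have := sE v; have := sE s; rewrite !brv !addr0 (ip_sym s v).
have : 0 <= c * (ip y y * ip b b) by rewrite !mulr_ge0 // ltW.
rewrite cy; lra.
Qed.

End AlmostAbelian.

End AlmostAbelianAlgebra.

(** * The Levi-Civita connection of a left-invariant metric *)

Section Koszul.
Context {R : realType} {n : nat} {G : lieGroupType R n}.
Variables (g : G -> 'rV[R]_n -> 'rV[R]_n -> R).
Hypotheses (gm : riemannian_metric g) (gl : left_invariant_metric g).
Implicit Types (u v : G) (x y z : 'rV[R]_n).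
Local Notation L := (fun x => left_invariant_vf x : G -> 'rV[R]_n).
Local Notation ip := (g 1%g).
Local Notation "[[ x , y ]]" := (lie_bracket G x y) (at level 0).

Lemma metric_left u x y : g u (L x u) (L y u) = ip x y.
Proof. by have := gl u 1%g x y; rewrite mulg1. Qed.

Lemma metric_nondegenerate u x y : (forall z, g u x (L z u) = g u y (L z u)) -> x = y.
Proof.
move=> h; apply/subr0_eq; apply: (ip_eq0 (metric_pos gm u)).
have [z zE] := left_vf_surj u (x - y).
by rewrite -{2}zE (ipBl (metric_linear gm u)) h subrr.
Qed.

Variables (nabla : (G -> 'rV[R]_n) -> (G -> 'rV[R]_n) -> G -> 'rV[R]_n) (c : R).
Hypothesis LC : levi_civita g nabla.

(** Inner products of left-invariant fields are constant, so the derivative terms of the Koszul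
    formula disappear; the rest is linear elimination among three metric and three torsion
    identities. *)
Lemma koszul u x y z : 2 * g u (nabla (L x) (L y) u) (L z u) =
  ip [[x, y]] z - ip [[y, z]] x + ip [[z, x]] y.
Proof.
have sm x' : smooth_vf (L x') by exact: left_vf_smooth.
have M a b d : g u (nabla (L a) (L b) u) (L d u) + g u (L b u) (nabla (L a) (L d) u) = 0.
  rewrite -(nabla_metric LC (sm a) (sm b) (sm d)).
  have -> : (fun v => g v (L b v) (L d v)) = cst (ip b d).
    by apply/funext => v; exact: metric_left.
  exact: derive_cst.
have T a b d : g u (nabla (L a) (L b) u) (L d u) - g u (nabla (L b) (L a) u) (L d u) =
    ip [[a, b]] d.
  rewrite -(ipBl (metric_linear gm u)) (nabla_torsion_free LC (sm a) (sm b)).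
  by rewrite left_vf_bracket metric_left.
have alg (xyz xzy yzx yxz zxy zyx bxy byz bzx : R) :
    xyz + xzy = 0 -> yzx + yxz = 0 -> zxy + zyx = 0 ->
    xyz - yxz = bxy -> yzx - zyx = byz -> zxy - xzy = bzx ->
    2 * xyz = bxy - byz + bzx by move=> *; lra.
apply: alg (T x y z) (T y z x) (T z x y).
- by have := M x y z; rewrite [X in _ + X](Defs.metric_sym gm).
- by have := M y z x; rewrite [X in _ + X](Defs.metric_sym gm).
- by have := M z x y; rewrite [X in _ + X](Defs.metric_sym gm).
Qed.

Definition left_nabla x y : 'rV[R]_n := nabla (L x) (L y) 1%g.

Lemma left_nablaE x y z : 2 * ip (left_nabla x y) z =
  ip [[x, y]] z - ip [[y, z]] x + ip [[z, x]] y.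
Proof. by rewrite -(koszul 1%g) left_vf1. Qed.

(** The right-hand side of [koszul] does not depend on the point. Iterated covariant derivatives
    thus stay among left-invariant fields, and the curvature becomes pure algebra. *)
Lemma nabla_left x y : nabla (L x) (L y) = L (left_nabla x y).
Proof.
apply/funext => u; apply: (@metric_nondegenerate u) => z.
have two : (2 : R) != 0 by [].
by apply: (mulfI two); rewrite metric_left left_nablaE koszul.
Qed.

Hypothesis sec : forall u X Y, smooth_vf X -> smooth_vf Y -> free [:: X u; Y u] ->
  sectional_curvature g nabla X Y u = c.

Lemma left_curvature x y z : curvature nabla (L x) (L y) (L z) 1%g =
  left_nabla x (left_nabla y z) - left_nabla y (left_nabla x z) - left_nabla [[x, y]] z.
Proof. by rewrite /curvature left_vf_bracket !nabla_left !left_vf1. Qed.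

Lemma free_orthogonal x b : x != 0 -> b != 0 -> ip x b = 0 -> free [:: x; b].
Proof.
move=> x0 b0 xb; rewrite free_cons span_seq1 seq1_free b0 andbT.
apply/negP => /vlineP [k xk].
have := metric_pos gm 1%g x0; rewrite {2}xk.
by rewrite (ipZr (metric_linear gm 1%g) (Defs.metric_sym gm 1%g)) xb mulr0 ltxx.
Qed.

Lemma left_sectional x b : x != 0 -> b != 0 -> ip x b = 0 ->
  ip (left_nabla x (left_nabla b b) - left_nabla b (left_nabla x b) -
      left_nabla [[x, b]] b) x = c * (ip x x * ip b b).
Proof.
move=> x0 b0 xb; rewrite -left_curvature.
have := @sec 1%g (L x) (L b) (left_vf_smooth x) (left_vf_smooth b).
rewrite !left_vf1 => /(_ (free_orthogonal x0 b0 xb)) <-.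
rewrite /sectional_curvature !left_vf1 xb expr0n /= subr0 divfK //.
by rewrite mulf_neq0 // gt_eqF // (metric_pos gm).
Qed.

End Koszul.

Section ConstantCurvature.
Context {R : realType} {n : nat} {G : lieGroupType R n}.
Variables (g : G -> 'rV[R]_n -> 'rV[R]_n -> R) (c : R).
Hypotheses (n_ge2 : (2 <= n)%N) (gm : riemannian_metric g)
  (gl : left_invariant_metric g) (c_neq0 : c != 0)
  (gc : constant_sectional_curvature g c) (aa : almost_abelian G).

(* b spans the orthogonal complement of the abelian ideal. *)
Lemma almost_abelian_normal : exists b,
  ~ (forall x, g 1%g (lie_bracket G b x) x = 0) /\
  (forall T, Dera g T -> b *m T = 0).
Proof.
have [nabla LC sec] := gc; have [h [dimh h_ideal h_abelian]] := aa.
have lin := metric_linear gm 1%g; have sym := Defs.metric_sym gm 1%g.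
have pos := metric_pos gm 1%g.
have [b b0 hn] := exists_normal lin sym pos dimh.
have dh : (0 < \dim h)%N by rewrite -ltnS; apply: leq_trans n_ge2 (eq_leq (esym dimh)).
have brl := @lie_bracket_linear R n G; have brC := @lie_bracketC R n G.
have nE := left_nablaE gm gl LC; have se := left_sectional gm gl LC sec.
exists b; split.
  refine (normal_not_skew lin sym pos brl brC nE se h_ideal h_abelian b0 hn c_neq0 dh).
move=> T [sk der].
refine (derivation_normal lin sym pos brl brC nE se h_ideal h_abelian b0 hn c_neq0 dh sk der).
Qed.

End ConstantCurvature.

(** * Dyadic roots *)

Section MatrixExponential.
Context {R : realType}.

Lemma norm_mulmx m n p (A : 'M[R]_(m, n)) (B : 'M[R]_(n, p)) :
  `|A *m B| <= n%:R * `|A| * `|B|.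
Proof.
apply: norm_le_entries => [|i j]; first by rewrite !mulr_ge0.
rewrite mxE; apply: le_trans (ler_norm_sum _ _ _) _.
apply: (@le_trans _ _ (\sum_(k < n) `|A| * `|B|)).
  apply: ler_sum => k _; rewrite normrM; apply: ler_pM => //; exact: entry_le_norm.
by rewrite sumr_const card_ord -mulrA mulr_natl.
Qed.

Lemma norm_exprmx n (A : 'M[R]_n) k : `|A ^+ k| <= (n%:R * `|A|) ^+ k.
Proof.
elim: k => [|k IH].
  rewrite !expr0; apply: norm_le_entries => // i j.
  by rewrite [X in `|X|](mxE) ; case: (i == j); rewrite ?normr1 ?normr0.
rewrite !exprS; apply: le_trans (norm_mulmx _ _) _.
by rewrite ler_wpM2l // mulr_ge0.
Qed.

Lemma cvg_expm_series n (A : 'M[R]_n) :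
  cvgn (series (fun k => (k`!%:R)^-1 *: A ^+ k)).
Proof.
apply: (@cvg_summable_increments _ _ _ _ (exp_coeff (n%:R * `|A|))).
  move=> k; rewrite seriesSB normrZ /exp_coeff /=.
  by rewrite ger0_norm ?invr_ge0 // mulrC ler_wpM2r ?invr_ge0 // norm_exprmx.
exact: is_cvg_series_exp_coeff.
Qed.

Lemma cvg_mulmx_l m n p (b : 'M[R]_(m, n)) (S : nat -> 'M[R]_(n, p)) (l : 'M[R]_(n, p)) :
  S @ \oo --> l -> (fun k => b *m S k) @ \oo --> b *m l.
Proof.
move=> Sl; apply/cvgrPdist_lt => e e0.
have L : (fun k => n%:R * `|b| * `|l - S k|) @ \oo --> (0 : R).
  rewrite -(mulr0 (n%:R * `|b|)); apply: cvgM; first exact: cvg_cst.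
  rewrite -(@normr0 _ 'M[R]_(n, p)) -(subrr l).
  by apply: cvg_norm; apply: cvgB => //; exact: cvg_cst.
move/cvgrPdist_lt : L => /(_ e e0); apply: filterS => k.
rewrite sub0r normrN => /(le_lt_trans (ler_norm _)); apply: le_lt_trans.
by rewrite -mulmxBr norm_mulmx.
Qed.

Lemma mulmx_expm_fixed n (b : 'rV[R]_n) (A : 'M[R]_n) : b *m A = 0 -> b *m expm A = b.
Proof.
move=> bA.
have c := cvg_mulmx_l (b := b) (cvg_expm_series (A := A)).
(* The sum with no terms is 0, so constancy starts at [k.+1]. *)
have part k : b *m series (fun k => (k`!%:R)^-1 *: A ^+ k) k.+1 = b.
  elim: k => [|k IH].
    by rewrite /series /= big_nat1 expr0 fact0 invr1 scale1r mulmx1.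
  rewrite /series /= big_nat_recr //= mulmxDr [X in X + _]IH.
  by rewrite exprS -scalemxAr mulmxA bA mul0mx scaler0 addr0.
have c' : (fun k => b *m series (fun k => (k`!%:R)^-1 *: A ^+ k) k) @ \oo --> b.
  rewrite -(cvg_shiftS (fun k => b *m series (fun k => (k`!%:R)^-1 *: A ^+ k) k)).
  by under eq_fun do rewrite /= part; exact: cvg_cst.
exact: (cvg_unique _ c c').
Qed.

End MatrixExponential.

Section Diagonal.
Context {R : realType} {V : normedModType R}.

Definition diagonal (x : V) : V * V := (x, x).

Fact diagonal_linear : linear diagonal.
Proof. by move=> a x y. Qed.

HB.instance Definition _ := GRing.isLinear.Build R V (V * V)%type _ diagonal diagonal_linear.

Lemma diagonal_continuous : continuous diagonal.
Proof. by move=> x; apply: cvg_pair; exact: cvg_id. Qed.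

End Diagonal.

Section DyadicRoots.
Context {R : realType} {n : nat}.
Local Notation V := 'rV[R]_n.

(* The values u j play the role of exp (2^-j b). *)
Definition dyadic_roots {G : lieGroupType R n} (b : V) (u : nat -> G) : Prop :=
  [/\ forall j, (u j.+1 * u j.+1)%g = u j, u @ \oo --> (1%g : G) &
      (fun j => 2 ^+ j *: (chart (1%g : G) (u j) - chart (1%g : G) (1%g : G))) @ \oo --> b].

Context {G : lieGroupType R n}.
Local Notation o := (1%g : G).
Local Notation po := (chart (1%g : G) (1%g : G)).

Definition csquare (a : V) : V := cmul o o o (po + a, po + a) - po.

(** At the pair of identities the differential of the product is the sum of its two arguments, since
    the right- and left-invariant fields of [x] both have value [x] at the identity. On the diagonal
    this is multiplication by 2, and [quadratic_remainder] supplies the bound. *)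
Lemma csquare_doubling : exists K r : R, nearly_doubling csquare K r /\
  forall a, `|a| < r -> cmul_dom o o o (po + a, po + a).
Proof.
pose F (p : V) := cmul o o o (diagonal p + 0).
pose A := [set p : V | cmul_dom o o o (diagonal p + 0)].
have FE p : F p = cmul o o o (p, p) by rewrite /F addr0.
have AE p : A p = cmul_dom o o o (p, p) by rewrite /A /mkset addr0.
have D : cmul_dom o o o (po, po) by exact/cmul_dom_left/chart_cod_self.
have sF : smooth_on A F.
  exact: smooth_on_affine 0 diagonal_continuous (@cmul_dom_open _ _ _ o o o) (cmul_smooth o o o).
have oA : open A.
  have c : continuous (fun p : V => diagonal p + 0).
    move=> p; apply: differentiable_continuous.
    by have [] := @diff_affine R _ _ diagonal 0 p diagonal_continuous.
  by have /continuousP := c; apply; exact: cmul_dom_open.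
have Apo : A po by rewrite AE.
have dcm := smooth_on_differentiable (cmul_smooth o o o) D.
have dF x : 'd F po x = 2 *: x.
  have [dA DA] := @diff_affine R _ _ diagonal 0 po diagonal_continuous.
  have dcm' : differentiable (cmul o o o) (diagonal po + 0) by rewrite addr0.
  have E : \forall y \near po, F y = cmul o o o (diagonal y + 0) by near=> y.
  have [_ DF] := diff_comp_near dA dcm' E.
  have d1 : 'd (cmul o o o) (po, po) (x, 0) = x.
    rewrite -(deriveE _ dcm) -right_vf_chart; last exact: chart_cod_self.
    by rewrite vf_in_chart_center right_vf1.
  have d2 : 'd (cmul o o o) (po, po) (0, x) = x.
    rewrite -(deriveE _ dcm) -left_vf_chart; last exact: chart_cod_self.
    by rewrite vf_in_chart_center left_vf1.
  have dxx : (x, x) = (x, 0) + (0, x) :> V * V.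
    by apply/pair_equal_spec; split; rewrite /= ?addr0 ?add0r.
  have d12 : 'd (cmul o o o) (po, po) (x, x) = 2 *: x.
    rewrite dxx; apply: etrans (linearD _ _ _) _.
    by apply: etrans (congr2 +%R d1 d2) _; rewrite scaler_nat mulr2n.
  by apply: (etrans (DF x)); rewrite (congr1 (fun f => f x) DA) addr0; exact: d12.
have [K [r [K0 r0 rA HK]]] := quadratic_remainder oA Apo sF.
have cen (a : V) : po + a - po = a by rewrite addrC addKr.
exists K, r; split; last first.
  by move=> a ar; rewrite -AE; apply: rA; rewrite cen.
split=> //; first by rewrite /csquare addr0 /cmul /= !chart_inv_self mulg1 subrr.
move=> x y M xr yr xM yM.
have := HK (po + x) (po + y) M; rewrite !cen => /(_ xr yr xM yM).
have -> : po + x - (po + y) = x - y by rewrite opprD addrACA subrr add0r.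
by rewrite dF !FE /csquare opprB addrA subrK.
Unshelve. all: by end_near. Qed.

Lemma dyadic_roots_chart0 b (u : nat -> G) : dyadic_roots b u ->
  (fun j => chart o (u j)) @ \oo --> po.
Proof.
move=> [_ u1 _]; apply: continuous_cvg u1.
exact/chart_continuous/mem_chart_dom.
Qed.

Lemma dyadic_roots_dom b (u : nat -> G) : dyadic_roots b u ->
  \forall j \near \oo, chart_dom o (u j).
Proof. by move=> [_ u1 _]; exact: u1 (near_dom (mem_chart_dom o)). Qed.

Lemma dyadic_roots_csquare b (u : nat -> G) : dyadic_roots b u ->
  \forall j \near \oo, csquare (chart o (u j.+1) - po) = chart o (u j) - po.
Proof.
move=> ub; have [sq _ _] := ub.
have [N _ HN] := dyadic_roots_dom ub.
exists N => // j jN /=; rewrite /csquare /cmul /= subrKC chartK ?sq //.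
exact: HN (leqW jN).
Qed.

(** The chart shows equality only for large [j]; squaring carries it down to every smaller index. *)
Lemma dyadic_roots_unique b (u u' : nat -> G) :
  dyadic_roots b u -> dyadic_roots b u' -> u =1 u'.
Proof.
move=> ub ub'; have [K [r [dbl _]]] := csquare_doubling.
have [sq _ tb] := ub; have [sq' _ tb'] := ub'.
have E := dyadic_root_unique dbl (dyadic_roots_csquare ub) (dyadic_roots_csquare ub') tb tb'.
have N : \forall j \near \oo, u j = u' j.
  near=> j.
  have Ej : chart o (u j) - po = chart o (u' j) - po by near: j; exact: E.
  have dj : chart_dom o (u j) by near: j; exact: dyadic_roots_dom ub.
  have dj' : chart_dom o (u' j) by near: j; exact: dyadic_roots_dom ub'.
  by rewrite -(chartK _ _ dj) -(chartK _ _ dj') (addIr _ Ej).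
have [J _ HJ] := N.
have down k j : (J <= j + k)%N -> u j = u' j.
  elim: k j => [|k IH] j; first by rewrite addn0 => /HJ.
  by rewrite addnS -addSn => /IH h; rewrite -sq -sq' h.
by move=> j; apply: (down J); exact: leq_addl.
Unshelve. all: by end_near. Qed.

Lemma dyadic_roots_exists b : exists u : nat -> G, dyadic_roots b u.
Proof.
have [K [r [dbl dom]]] := csquare_doubling.
have [j0 [a [ja ab]]] := dyadic_root_exists dbl b.
pose x j := chart_inv o (po + a j).
have xdom j : (j0 <= j)%N -> chart_cod o (po + a j).
  by move=> /ja[_ /dom[]].
have sqx j : (j0 <= j)%N -> (x j.+1 * x j.+1)%g = x j.
  move=> jj; have [pj aj] := ja j jj; have [_ aj'] := ja j.+1 (leqW jj).
  have [/= _ _ D] := dom _ aj'.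
  by rewrite /x -[LHS](chartK _ _ D) -[a j]pj /csquare /cmul /= subrKC.
have xpow k j : (j0 <= j)%N -> (x (j + k)%N ^+ (2 ^ k))%g = x j.
  elim: k j => [|k IH] j jj; first by rewrite addn0 expg1.
  by rewrite addnS -addSn expnSr expgnA IH ?(leqW jj) // expgS expg1 sqx.
have a0 : a @ \oo --> (0 : V).
  have h0 : (fun j : nat => 2^-1 ^+ j : R) @ \oo --> (0 : R).
    by apply: cvg_expr; rewrite ger0_norm // invf_lt1 // ltr1n.
  rewrite -(scale0r b).
  have -> : a = (fun j => 2^-1 ^+ j *: (2 ^+ j *: a j)).
    by apply/funext => j; rewrite scalerA -exprMn mulVf // expr1n scale1r.
  exact: cvgZ.
(* The [x j] are successive square roots only from [j0] on. Shifting by [j0] and taking powers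
   [2 ^ j0] yields a sequence valid from 0, which agrees with [x] beyond [j0]. *)
pose u j := (x (j + j0)%N ^+ (2 ^ j0))%g.
have ux : \forall j \near \oo, x j = u j.
  by exists j0 => // j jj; rewrite /u xpow.
exists u; split.
- move=> j; rewrite /u -expgnDr addnn -muln2 mulnC expgnA addSn.
  by rewrite (expgS _ 1) expg1 sqx // leq_addl.
- apply: cvg_trans (near_eq_cvg ux) _.
  have pa : (fun j => po + a j) @ \oo --> po.
    have : (fun j => po + a j) @ \oo --> po + 0 by apply: cvgD => //; exact: cvg_cst.
    by rewrite addr0.
  have := @continuous_cvg _ _ _ _ _ (fun j => po + a j) (chart_inv o) po
    (chart_inv_continuous o po (chart_cod_self o)) pa.
  by rewrite chart_inv_self => H; exact: (H _).
- apply: cvg_trans ab; apply: near_eq_cvg; exists j0 => // j jj /=.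
  have xu : x j = u j by rewrite /u xpow.
  by rewrite -xu /x (chart_invK (xdom j jj)) addrAC subrr add0r.
Qed.

End DyadicRoots.

Section Homomorphisms.
Context {R : realType} {n : nat}.

Lemma group_morphism1 (G H : lieGroupType R n) (f : G -> H) :
  group_morphism f -> f 1%g = 1%g.
Proof.
move=> fM; have := fM 1%g 1%g; rewrite mulg1 => E.
by apply: (mulgI (f 1%g)); rewrite mulg1 -E.
Qed.

(** A morphism commutes with squaring, and its differential transforms the velocity, by
    [diff_seq]. *)
Lemma dyadic_roots_morphism (G H : lieGroupType R n) (f : G -> H) b (u : nat -> G) :
    group_morphism f -> mdifferentiable f 1%g -> dyadic_roots b u ->
  dyadic_roots (mdiff f 1%g b) (f \o u).
Proof.
move=> fM [fc fd] ub; have [sq u1 tb] := ub; have f1 := group_morphism1 fM.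
split.
- by move=> j /=; rewrite -fM sq.
- have H1 : (fun j => f (u j)) @ \oo --> f 1%g by apply: continuous_cvg u1; exact: fc.
  by rewrite f1 in H1.
- have L := diff_seq fd (dyadic_roots_chart0 ub) tb.
  rewrite f1 in L; rewrite /mdiff f1; apply: cvg_trans L.
  apply: near_eq_cvg; apply: filterS (dyadic_roots_dom ub) => j uj /=.
  by rewrite chartK // chart_inv_self f1.
Qed.

(** A local inverse provides a one-sided inverse of the differential; for square matrices it is
    two-sided, which gives surjectivity. *)
Lemma local_diffeomorphism_bijective (G H : lieGroupType R n) (f : G -> H) :
    local_diffeomorphism f ->
  injective (mdiff f (1%g : G)) /\ forall y, exists x, mdiff f (1%g : G) x = y.
Proof.
move=> [sf ld]; have [U [s [oU U1 ofU sK ss]]] := ld 1%g.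
have df : mdifferentiable f (1%g : G) by exact: smooth_map_on_mdifferentiable sf _.
have ds : mdifferentiable s (f 1%g).
  by apply: smooth_map_on_mdifferentiable ss _; exists 1%g.
have K x : mdiff s (f 1%g) (mdiff f (1%g : G) x) = x.
  apply: etrans (esym (mdiff_comp x df ds)) _; apply: mdiff_near_id.
  by apply: filterS (open_nbhs_nbhs (conj oU U1)) => v /sK.
split=> [x y xy|y]; first by rewrite -(K x) xy K.
pose A := lin1_mx ('d (chart (f 1%g) \o f \o chart_inv (1%g : G)) (chart (1%g : G) (1%g : G))).
pose B := lin1_mx ('d (chart (s (f 1%g)) \o s \o chart_inv (f 1%g)) (chart (f 1%g) (f 1%g))).
have AE x : mdiff f (1%g : G) x = x *m A by rewrite mul_rV_lin1.
have BE x : mdiff s (f 1%g) x = x *m B by rewrite mul_rV_lin1.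
clearbody A B.
have h (x : 'rV[R]_n) : x *m (A *m B) = x.
  by rewrite mulmxA -(AE x) -(BE (mdiff f 1%g x)) K.
have AB : A *m B = 1%:M by apply/row_matrixP => i; rewrite !rowE mulmx1 h.
exists (y *m B); apply: etrans (AE _) _.
by rewrite -mulmxA (mulmx1C AB) mulmx1.
Qed.

Lemma induced_killing_vf1 (G : lieGroupType R n) T (xi : G -> 'rV[R]_n) :
  induced_killing_vf T xi -> xi 1%g = 0.
Proof.
move=> [Gt [pi [f [xit [[sc piM pis pild] fa ffix dxi xiE]]]]].
have p1 := group_morphism1 piM.
have x0 : xit 1%g = 0.
  have [_ <-] := dxi 1%g.
  have -> : (fun t => chart 1%g (f t 1%g)) = cst (chart (1%g : Gt) 1%g).
    by apply/funext => t; have [[_ fM _] _] := fa t; rewrite group_morphism1.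
  exact: derive_cst.
by rewrite -p1 xiE x0 /mdiff linear0.
Qed.

(* The automorphisms f t fix the lifted roots by uniqueness, so that their
   velocity vanishes there. *)
Lemma induced_killing_vf_roots (G : lieGroupType R n) T (xi : G -> 'rV[R]_n) b
    (u : nat -> G) :
  b *m T = 0 -> induced_killing_vf T xi -> dyadic_roots b u -> forall j, xi (u j) = 0.
Proof.
move=> bT [Gt [pi [f [xit [[sc piM pis pild] fa ffix dxi xiE]]]]] ub j.
have [inj surj] := local_diffeomorphism_bijective pild.
have dpi : mdifferentiable pi (1%g : Gt).
  by have [sp _] := pild; exact: smooth_map_on_mdifferentiable sp _.
have [bt btE] := surj b.
have [ut utb] := @dyadic_roots_exists R n Gt bt.
have pu : pi (ut j) = u j.
  have := dyadic_roots_morphism piM dpi utb; rewrite btE => h.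
  exact: dyadic_roots_unique h ub j.
have fu t : f t (ut j) = ut j.
  have [[fs fM _] fd] := fa t.
  have df : mdifferentiable (f t) 1%g by exact: smooth_map_on_mdifferentiable fs _.
  (* Seen through the injective differential of [pi], the differential of [f t] is [expm (t *: T)],
     which fixes [b] because [b *m T = 0]. *)
  have E : mdiff (f t) (1%g : Gt) bt = bt.
    apply: inj; have := fd bt; rewrite btE mulmx_expm_fixed ?(group_morphism1 fM) //.
    by rewrite -scalemxAr bT scaler0.
  have := dyadic_roots_morphism fM df utb; rewrite E => h.
  exact: dyadic_roots_unique h utb j.
have x0 : xit (ut j) = 0.
  have [_ <-] := dxi (ut j).
  have -> : (fun t => chart (ut j) (f t (ut j))) = cst (chart (ut j) (ut j)).
    by apply/funext => t; rewrite fu.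
  exact: derive_cst.
by rewrite -pu xiE x0 /mdiff linear0.
Qed.

(** For an induced field both sides are 0, since it vanishes at the identity as well as at the
    roots. *)
Lemma generator_right_translation (G : lieGroupType R n)
    (g : G -> 'rV[R]_n -> 'rV[R]_n -> R) (xi : G -> 'rV[R]_n) b (u : nat -> G) :
    (forall T, Dera g T -> b *m T = 0) -> dyadic_roots b u -> killing_generator g xi ->
  forall j, xi (u j) = right_invariant_vf (xi 1%g) (u j).
Proof.
move=> bD ub [[x ->]|[T DT xiT]] j; first by rewrite right_vf1.
rewrite (induced_killing_vf_roots (bD T DT) xiT ub) (induced_killing_vf1 xiT).
by rewrite /right_invariant_vf /mdiff linear0.
Qed.

(** Both fields have value [x] at the identity, so the rescaled difference tends to the difference
    of their derivatives along [b]. By [left_right_commute], the right-hand one is the derivative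
    along [x] of the left field of [b], which completes the bracket. *)
Lemma right_left_difference (G : lieGroupType R n) b x (u : nat -> G) :
    dyadic_roots b u ->
  (fun j => 2 ^+ j *:
     (vf_in_chart (left_invariant_vf x) (1%g : G) (chart (1%g : G) (u j)) -
      vf_in_chart (right_invariant_vf x) (1%g : G) (chart (1%g : G) (u j))))
    @ \oo --> lie_bracket G b x.
Proof.
move=> ub; have [_ _ tb] := ub; have p0 := dyadic_roots_chart0 ub.
have co := chart_cod_self (1%g : G).
have dL := smooth_on_differentiable (left_vf_smooth x (1%g : G)) co.
have dR := smooth_on_differentiable (right_vf_smooth x (1%g : G)) co.
have cL := diff_seq dL p0 tb; have cR := diff_seq dR p0 tb.
rewrite vf_in_chart_center left_vf1 -(deriveE _ dL) in cL.
rewrite vf_in_chart_center right_vf1 -(deriveE _ dR) left_right_commute in cR.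
have alg (k : R) (l r : 'rV[R]_n) : k *: (l - x) - k *: (r - x) = k *: (l - r).
  by rewrite -scalerBr opprB addrA subrK.
rewrite lie_bracketE; apply: cvg_trans (cvgB cL cR).
apply: near_eq_cvg; apply: filterS (dyadic_roots_dom ub) => j _.
exact: alg.
Qed.

End Homomorphisms.

(** * The metric tensor *)

Section TensorMatrices.
Context {R : realType} {n : nat}.
Implicit Types (S : @tensor R n 2) (N : 'M[R]_n).

Definition tensor_mx S : 'M[R]_n := \matrix_(k, l) S [tuple k; l].

Lemma tensor_mx_sum (I : Type) (r : seq I) (P : pred I) (F : I -> @tensor R n 2) :
  tensor_mx (\sum_(i <- r | P i) F i) = \sum_(i <- r | P i) tensor_mx (F i).
Proof.
apply/matrixP => k l; rewrite mxE summxE sum_ffunE.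
by apply: eq_bigr => i _; rewrite mxE.
Qed.

Lemma tensor_mxZ (a : R) S : tensor_mx (a *: S) = a *: tensor_mx S.
Proof. by apply/matrixP => k l; rewrite !mxE ffunE. Qed.

Lemma tensor_mx_symprod (v : 'I_2 -> 'rV[R]_n) :
  tensor_mx (symprod v) = \sum_(s : 'S_2) (v (s 0))^T *m v (s 1).
Proof.
apply/matrixP => k l; rewrite mxE ffunE summxE; apply: eq_bigr => s _.
rewrite mxE big_ord1 mxE big_ord_recl big_ord1 /=.
by rewrite (_ : lift ord0 ord0 = 1 :> 'I_2) //; apply/val_inj.
Qed.

Lemma tensor_mx_symprod_const (e : 'rV[R]_n) :
  tensor_mx (symprod (fun=> e)) = 2 *: (e^T *m e).
Proof. by rewrite tensor_mx_symprod sumr_const card_Sn scaler_nat. Qed.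

Lemma monomial_factors_map k (m : mpoly.multinom k) (v : 'I_k -> 'rV[R]_n) N :
  monomial_factors m (fun i => v i *m N) = map (mulmx^~ N) (monomial_factors m v).
Proof.
rewrite /monomial_factors map_flatten -[in RHS]map_comp; congr flatten.
by apply: eq_map => i /=; rewrite map_nseq.
Qed.

(** Naturality of symmetric products: a linear map applied to every factor acts on degree 2 by
    congruence, whatever the polynomial. *)
Lemma tensor_mx_sym_eval k (P : mpoly.mpoly k R) (v : 'I_k -> 'rV[R]_n) N :
  tensor_mx (sym_eval P (fun i => v i *m N) 2) =
  N^T *m tensor_mx (sym_eval P v 2) *m N.
Proof.
rewrite /sym_eval !tensor_mx_sum mulmx_sumr mulmx_suml; apply: eq_bigr => m _.
rewrite !tensor_mxZ -scalemxAr -scalemxAl; congr (_ *: _).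
have E j : nth 0 (monomial_factors m (fun i => v i *m N)) j =
    nth 0 (monomial_factors m v) j *m N.
  (* Past the end of the list the default factor is 0, which [N] sends to 0. *)
  rewrite monomial_factors_map; have [jm|jm] := ltnP j (size (monomial_factors m v)).
    by rewrite (nth_map 0).
  by rewrite !nth_default ?size_map // mul0mx.
rewrite !tensor_mx_symprod mulmx_sumr mulmx_suml; apply: eq_bigr => s _.
by rewrite !E trmx_mul !mulmxA.
Qed.

Variables (b : 'rV[R]_n -> 'rV[R]_n -> R).
Hypotheses (b_linear : forall a x y z, b (a *: x + y) z = a * b x z + b y z)
  (b_sym : forall x y, b x y = b y x).

Definition gram : 'M[R]_n := \matrix_(k, l) b (delta_mx 0 k) (delta_mx 0 l).

Lemma suml_form (x z : 'rV[R]_n) : b x z = \sum_k x 0 k * b (delta_mx 0 k) z.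
Proof.
rewrite {1}[x]row_sum_delta; elim/big_rec2: _ => [|i s t _ <-]; first exact: ip0l.
by rewrite (ipDl b_linear) (ipZl b_linear).
Qed.

Lemma gramE (x y : 'rV[R]_n) : b x y = (x *m gram *m y^T) 0 0.
Proof.
rewrite suml_form -mulmxA mxE; apply: eq_bigr => k _; congr (_ * _).
rewrite b_sym suml_form mxE; apply: eq_bigr => l _.
by rewrite !mxE mulrC b_sym.
Qed.

(** With the orthonormal basis as rows of [E], the tensor is [E^T *m E], the factor 1/2 cancelling
    the two permutations. Orthonormality makes it the inverse of the Gram matrix, whichever basis
    was chosen. *)
Lemma metric_tensor_gram S : is_metric_tensor b S -> gram *m tensor_mx S = 1%:M.
Proof.
move=> [e ortho ->]; pose E : 'M[R]_n := \matrix_i e i.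
have TE : tensor_mx (2^-1 *: \sum_(i < n) symprod (fun=> e i)) = E^T *m E.
  rewrite tensor_mxZ tensor_mx_sum.
  under eq_bigr do rewrite tensor_mx_symprod_const.
  rewrite -scaler_sumr scalerA mulVf // scale1r.
  apply/matrixP => k l; rewrite summxE mxE; apply: eq_bigr => i _.
  by rewrite mxE big_ord1 !mxE.
have EG : E *m (gram *m E^T) = 1%:M.
  apply/matrixP => i j; rewrite [RHS]mxE -(ortho i j) gramE mulmxA [LHS]mxE [RHS]mxE.
  apply: eq_bigr => k _; congr (_ * _); last by rewrite !mxE.
  by rewrite [LHS]mxE [RHS]mxE; apply: eq_bigr => l _; rewrite !mxE.
by rewrite TE mulmxA (mulmx1C EG).
Qed.

End TensorMatrices.

Section FormLimits.
Context {R : realType} {n : nat}.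

Lemma cvg_form (B : nat -> 'rV[R]_n -> 'rV[R]_n -> R) (b : 'rV[R]_n -> 'rV[R]_n -> R)
    (y z : nat -> 'rV[R]_n) (y0 z0 : 'rV[R]_n) :
    (forall j a x y z, B j (a *: x + y) z = a * B j x z + B j y z) ->
    (forall j x y, B j x y = B j y x) ->
    (forall a x y z, b (a *: x + y) z = a * b x z + b y z) ->
    (forall x y, b x y = b y x) ->
    (forall x y, (fun j => B j x y) @ \oo --> b x y) ->
    y @ \oo --> y0 -> z @ \oo --> z0 ->
  (fun j => B j (y j) (z j)) @ \oo --> b y0 z0.
Proof.
move=> Bl Bs bl bs Bb yy zz.
have E (c : 'rV[R]_n -> 'rV[R]_n -> R) :
    (forall a x y z, c (a *: x + y) z = a * c x z + c y z) ->
    (forall x y, c x y = c y x) -> forall u v,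
    c u v = \sum_k u 0 k * \sum_l v 0 l * c (delta_mx 0 l) (delta_mx 0 k).
  move=> cl cs u v; rewrite (suml_form cl); apply: eq_bigr => k _.
  by rewrite cs (suml_form cl).
have ent (w : nat -> 'rV[R]_n) (w0 : 'rV[R]_n) k : w @ \oo --> w0 ->
    (fun j => w j 0 k : R) @ \oo --> (w0 0 k : R).
  move=> ww; apply: (@continuous_cvg _ _ _ _ _ w (fun A : 'rV[R]_n => A 0 k) w0) => //.
  exact: coord_continuous.
rewrite (E b bl bs) (_ : (fun j => B j (y j) (z j)) = (fun j => \sum_k y j 0 k *
  \sum_l z j 0 l * B j (delta_mx 0 l) (delta_mx 0 k))); last first.
  by apply/funext => j; exact: (E (B j) (Bl j) (Bs j)).
apply: cvg_big => [|k _]; first exact: add_continuous.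
apply: cvgM; first exact: ent.
apply: cvg_big => [|l _]; first exact: add_continuous.
by apply: cvgM; [exact: ent|exact: Bb].
Qed.

End FormLimits.

(** * Right translations as isometries *)

Section Translations.
Context {R : realType} {n : nat} {G : lieGroupType R n}.
Variables (g : G -> 'rV[R]_n -> 'rV[R]_n -> R).
Hypotheses (gm : riemannian_metric g) (gl : left_invariant_metric g).
Local Notation po := (chart (1%g : G) (1%g : G)).

(** Let [N] be the differential of right translation by [u]. The metric tensor at [u] is the
    congruence by [N] of the one at the identity; passing to inverses, the Gram matrices are related
    by [N] as well. *)
Lemma right_translation_isometry (k : nat) (xi : 'I_k -> G -> 'rV[R]_n)
    (P : mpoly.mpoly k R) (u : G) :
    metric_is_polynomial_in g xi P ->
    (forall i, xi i u = right_invariant_vf (xi i 1%g) u) ->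
  forall x, g u (right_invariant_vf x u) (right_invariant_vf x u) = g 1%g x x.
Proof.
move=> gP xiu.
pose N := lin1_mx ('d (chart (1%g * u)%g \o (fun v => (v * u)%g) \o chart_inv (1%g : G)) po).
have NE x : right_invariant_vf x u = x *m N by rewrite mul_rV_lin1.
clearbody N.
have [M1 _] := gP 1%g; have [Mu _] := gP u.
have E : (fun i => xi i u) = (fun i => xi i 1%g *m N).
  by apply/funext => i; rewrite xiu NE.
rewrite E in Mu.
have G1 := metric_tensor_gram (metric_linear gm 1%g) (Defs.metric_sym gm 1%g) M1.
have := metric_tensor_gram (metric_linear gm u) (Defs.metric_sym gm u) Mu.
rewrite tensor_mx_sym_eval; set T := tensor_mx _ in G1 *.
rewrite !mulmxA => Gu.
have K : N *m gram (g u) *m N^T = gram (g 1%g).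
  rewrite -[LHS]mulmx1 -(mulmx1C G1) mulmxA.
  by have := mulmx1C Gu; rewrite !mulmxA => ->; rewrite mul1mx.
move=> x; rewrite NE.
rewrite (gramE (metric_linear gm u) (Defs.metric_sym gm u)).
rewrite (gramE (metric_linear gm 1%g) (Defs.metric_sym gm 1%g)).
by rewrite -K trmx_mul !mulmxA.
Qed.

Lemma metric_in_chart_linear (p : 'rV[R]_n) (a : R) (x y z : 'rV[R]_n) :
  metric_in_chart g (1%g : G) (a *: x + y) z p =
  a * metric_in_chart g (1%g : G) x z p + metric_in_chart g (1%g : G) y z p.
Proof. by rewrite /metric_in_chart linearP (metric_linear gm). Qed.

Lemma metric_in_chart_sym (p x y : 'rV[R]_n) :
  metric_in_chart g (1%g : G) x y p = metric_in_chart g (1%g : G) y x p.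
Proof. exact: Defs.metric_sym gm _ _ _. Qed.

(* Lx and Rx have the same length at u j, and 2^j (Lx - Rx) tends to [b, x]. *)
Lemma isometric_roots_skew b (u : nat -> G) :
    dyadic_roots b u ->
    (forall j x, g (u j) (right_invariant_vf x (u j)) (right_invariant_vf x (u j)) =
       g 1%g x x) ->
  forall x, g 1%g (lie_bracket G b x) x = 0.
Proof.
move=> ub iso x.
(* Vectors at different [u j] can be compared and passed to the limit only in one fixed chart, the
   one at the identity. *)
pose p j := chart (1%g : G) (u j).
pose A := vf_in_chart (left_invariant_vf x) (1%g : G).
pose B := vf_in_chart (right_invariant_vf x) (1%g : G).
have co := chart_cod_self (1%g : G).
have p0 : p @ \oo --> po := dyadic_roots_chart0 ub.
have A0 : (fun j => A (p j)) @ \oo --> x.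
  have c := differentiable_continuous
    (smooth_on_differentiable (left_vf_smooth x (1%g : G)) co).
  have := continuous_cvg _ c p0; rewrite vf_in_chart_center left_vf1.
  by move=> H; exact: (H _).
have B0 : (fun j => B (p j)) @ \oo --> x.
  have c := differentiable_continuous
    (smooth_on_differentiable (right_vf_smooth x (1%g : G)) co).
  have := continuous_cvg _ c p0; rewrite vf_in_chart_center right_vf1.
  by move=> H; exact: (H _).
have D := right_left_difference (x := x) ub.
have S : (fun j => A (p j) + B (p j)) @ \oo --> x + x := cvgD A0 B0.
pose m q y z := metric_in_chart g (1%g : G) y z q.
have ml q := @metric_in_chart_linear q; have ms q := @metric_in_chart_sym q.
have mc y z : (fun j => m (p j) y z) @ \oo --> m po y z.
  have c := metric_smooth gm (1%g : G) y z 0%N po co.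
  have := continuous_cvg _ c p0.
  by move=> H; exact: (H _).
have L := cvg_form (B := fun j => m (p j)) (b := m po)
  (fun j => ml (p j)) (fun j => ms (p j)) (ml po) (ms po) mc D (S _).
(* [<v - w, v + w> = |v|^2 - |w|^2] is 0 for the left and right fields; its rescaled limit is
   [<[b, x], x + x>]. *)
have Z : (fun j => m (p j) (2 ^+ j *: (A (p j) - B (p j))) (A (p j) + B (p j)))
    @ \oo --> (0 : R).
  have C : (fun=> 0 : R) @ \oo --> (0 : R) by exact: cvg_cst.
  apply: cvg_trans C; apply: near_eq_cvg.
  apply: filterS (dyadic_roots_dom ub) => j uj /=.
  have cp : chart_cod (1%g : G) (p j) by exact: chart_cod_chart.
  have iu : chart_inv (1%g : G) (p j) = u j by exact: chartK.
  have eA : m (p j) (A (p j)) (A (p j)) = g 1%g x x.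
    by rewrite /m (metric_in_chartE g _ _ cp) iu (metric_left gl).
  have eB : m (p j) (B (p j)) (B (p j)) = g 1%g x x.
    by rewrite /m (metric_in_chartE g _ _ cp) iu iso.
  have alg (f : 'rV[R]_n -> 'rV[R]_n -> R) v w (t : R) :
      (forall a x y z, f (a *: x + y) z = a * f x z + f y z) ->
      (forall x y, f x y = f y x) -> f v v = f w w -> f (t *: (v - w)) (v + w) = 0.
    move=> fl fs vw; rewrite (ipZl fl) (ipBl fl) !(ipDr fl fs) vw (fs w v); ring.
  exact: esym (alg (m (p j)) (A (p j)) (B (p j)) (2 ^+ j) (ml (p j)) (ms (p j))
    (etrans eA (esym eB))).
have lim0 : m po (lie_bracket G b x) (x + x) = 0 by exact: (cvg_unique _ (L _) Z).
have mo y z : m po y z = g 1%g y z.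
  have := metric_in_chartE g (left_invariant_vf y) (left_invariant_vf z) co.
  by rewrite !vf_in_chart_center chart_inv_self !left_vf1.
move: lim0; rewrite mo (ipDr (metric_linear gm 1%g) (Defs.metric_sym gm 1%g)); lra.
Qed.

End Translations.

Theorem theorem6p4 (R : realType) (n : nat) (n_ge2 : (2 <= n)%N)
    (G : lieGroupType R n) (G_connected : connected [set: G])
    (G_almost_abelian : almost_abelian G)
    (g : G -> 'rV[R]_n -> 'rV[R]_n -> R)
    (g_metric : riemannian_metric g) (g_left_invariant : left_invariant_metric g)
    (c : R) (c_neq0 : c != 0)
    (g_curvature : constant_sectional_curvature g c) :
  ~ exists (k : nat) (xi : 'I_k -> G -> 'rV[R]_n) (P : mpoly.mpoly k R),
      (forall i, killing_generator g (xi i)) /\ metric_is_polynomial_in g xi P.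
Proof.
move=> [k [xi [P [gen gP]]]].
have [b [not_skew Dera_b]] := almost_abelian_normal n_ge2 g_metric g_left_invariant
  c_neq0 g_curvature G_almost_abelian.
have [u ub] := @dyadic_roots_exists R n G b.
apply: not_skew; apply: (isometric_roots_skew g_metric g_left_invariant ub) => j x.
apply: (right_translation_isometry g_metric gP) => i.
exact: generator_right_translation Dera_b ub (gen i) j.
Qed.
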